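(* Let $g=\lambda_+^2g_{Kerr}$ be the complex Kähler metric conformal to Kerr, with Levi-Civita connection $\nabla$, scalar curvature $s$, self-dual 2-forms $\omega,\Omega^\pm$ and 1-form $a$ as in the context. Let $d_+=P_+d:\Lambda^1\to\Lambda^+$ and $d_+^*=\delta P_+:\Lambda^2\to\Lambda^1$, where $\delta$ is the codifferential of $g$, and let $\Delta_H=d\delta+\delta d$ be the Hodge Laplacian of $g$ on 2-forms. Then $\mathcal{O}:=2d_+d_+^*=\Delta_HP_+$, and for all smooth complex functions $\Phi,\Phi^+,\Phi^-$, $$\mathcal{O}\big(\Phi\,\omega+\Phi^-\Omega^++\Phi^+\Omega^-\big)=\big(-\nabla^\alpha\nabla_\alpha\Phi\big)\,\omega+\big(\mathcal{O}_{-1}\Phi^-\big)\,\Omega^++\big(\mathcal{O}_{+1}\Phi^+\big)\,\Omega^-,$$ where $\mathcal{O}_{k}\Psi=-(\nabla^\alpha+{\rm i}ka^\alpha)(\nabla_\alpha+{\rm i}ka_\alpha)\Psi+\frac{1+2k^2}{6}s\Psi$, so that $\mathcal{O}_{\pm1}\Psi=-(\nabla^\alpha\pm{\rm i}a^\alpha)(\nabla_\alpha\pm{\rm i}a_\alpha)\Psi+\frac{s}{2}\Psi$. In particular $\mathcal{O}$ preserves each of the line subbundles of $\Lambda^+$ spanned by $\omega$, $\Omega^+$, $\Omega^-$.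
   Context: Coordinates $(t,r,q,\phi)$ on the region where $C(r)=r^2-2Mr+a^2>0$ and $-1<q<1$; $D(q)=1-q^2$, $\rho^2=r^2+a^2q^2$, $M,a$ real. Coframe: $e^0=\frac{\sqrt C}{\rho}(dt-a(1-q^2)d\phi)$, $e^1=\frac{\rho}{\sqrt C}dr$, $e^2=\frac{\rho}{\sqrt D}dq$, $e^3=\frac{\sqrt D}{\rho}((r^2+a^2)d\phi-a\,dt)$; the Kerr metric is $g_{Kerr}=-e^0\otimes e^0+\sum_{i=1}^3e^i\otimes e^i$. Set $\Sigma^1={\rm i}e^0\wedge e^1-e^2\wedge e^3$, $\Sigma^2={\rm i}e^0\wedge e^2-e^3\wedge e^1$, $\Sigma^3={\rm i}e^0\wedge e^3-e^1\wedge e^2$. Let $\lambda_\pm=1/(r\pm{\rm i}aq)$, $g=\lambda_+^2g_{Kerr}$ (complex-valued), $\Omega^i=\lambda_+^2\Sigma^i$, $\omega=\Omega^1$, $\Omega^\pm=(\Omega^2\pm{\rm i}\Omega^3)/\sqrt2$. $\Lambda^+$ is the complex span of $\Omega^1,\Omega^2,\Omega^3$ (the self-dual 2-forms); $\star$ denotes the Hodge star on 2-forms (conformally invariant, the same for $g$ and $g_{Kerr}$) with orientation such that $\star\Sigma^i={\rm i}\Sigma^i$, and $P_+=\frac12(1-{\rm i}\star)$ is the projector onto $\Lambda^+$. The codifferential is $(\delta B)_\nu=-\nabla^\mu B_{\mu\nu}$ on 2-forms and $\delta\theta=-\nabla^\mu\theta_\mu$ on 1-forms, indices raised with $g$. The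 metric $g$ satisfies $\nabla\omega=0$, and $a$ is the (unique) complex 1-form with $(\nabla_\mu+{\rm i}a_\mu)\Omega^+_{\rho\sigma}=0$ and $(\nabla_\mu-{\rm i}a_\mu)\Omega^-_{\rho\sigma}=0$. In $\mathcal{O}_k$, $(\nabla_\alpha+{\rm i}ka_\alpha)\Psi=\partial_\alpha\Psi+{\rm i}ka_\alpha\Psi$ and $(\nabla^\alpha+{\rm i}ka^\alpha)v_\alpha=\nabla^\alpha v_\alpha+{\rm i}ka^\alpha v_\alpha$. *)

(* Defs.v *)
(* Stdlib reals + Coquelicot (complex numbers C, Derive).
   Everything is written in the coordinates (t,r,q,phi) = (x 0, x 1, x 2, x 3). *)
From Stdlib Require Import Reals Lra List.
From Coquelicot Require Import Coquelicot.
Open Scope R_scope.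

(* points of the coordinate chart: only indices 0..3 are used *)
Definition R4 := nat -> R.
Definition Fn := R4 -> C.
Definition Form1 := nat -> Fn.
Definition Form2 := nat -> nat -> Fn.  (* B_{mu nu}, B = 1/2 B_{mu nu} dx^mu ^ dx^nu *)
Definition Form3 := nat -> nat -> nat -> Fn.

Definition sum4 (f : nat -> C) : C := (f 0%nat + f 1%nat + f 2%nat + f 3%nat)%C.

Definition shift (x : R4) (mu : nat) (s : R) : R4 :=
  fun i => if Nat.eqb i mu then x i + s else x i.

Definition pd (mu : nat) (F : Fn) : Fn := fun x =>
  (Derive (fun s => fst (F (shift x mu s))) 0, Derive (fun s => snd (F (shift x mu s))) 0).

Definition iter_pd (l : list nat) (F : Fn) : Fn := fold_right pd F l.

Definition cont_at (G : Fn) (x : R4) : Prop :=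
  forall eps, 0 < eps -> exists delta, 0 < delta /\
    forall y : R4, (forall i, (i < 4)%nat -> Rabs (y i - x i) < delta) ->
      Cmod (G y - G x)%C < eps.

Definition smooth_on (D : R4 -> Prop) (F : Fn) : Prop :=
  forall (l : list nat), List.Forall (fun mu => (mu < 4)%nat) l ->
    forall x, D x ->
      cont_at (iter_pd l F) x /\
      forall mu, (mu < 4)%nat ->
        ex_derive (fun s => fst (iter_pd l F (shift x mu s))) 0 /\
        ex_derive (fun s => snd (iter_pd l F (shift x mu s))) 0.

Section Kerr.
(* M : mass, a : rotation parameter (real) *)
Variables M a : R.

Definition Cr (r : R) := r ^ 2 - 2 * M * r + a ^ 2.
Definition Dq (q : R) := 1 - q ^ 2.
Definition rho2 (r q : R) := r ^ 2 + a ^ 2 * q ^ 2.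
Definition rho (r q : R) := sqrt (rho2 r q).

(* the region: C(r) > 0, -1 < q < 1 (and rho <> 0, where the metric is defined) *)
Definition KerrDom (x : R4) : Prop :=
  0 < Cr (x 1%nat) /\ -1 < x 2%nat < 1 /\ 0 < rho2 (x 1%nat) (x 2%nat).

(* coframe components: e^A = sum_mu cof A mu dx^mu *)
Definition cof (A mu : nat) (x : R4) : R :=
  let r := x 1%nat in let q := x 2%nat in
  let sC := sqrt (Cr r) in let sD := sqrt (Dq q) in let p := rho r q in
  match A, mu with
  | 0%nat, 0%nat => sC / p
  | 0%nat, 3%nat => - a * (1 - q ^ 2) * sC / p
  | 1%nat, 1%nat => p / sC
  | 2%nat, 2%nat => p / sD
  | 3%nat, 0%nat => - a * sD / p
  | 3%nat, 3%nat => (r ^ 2 + a ^ 2) * sD / p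
  | _, _ => 0
  end.

(* dual frame: E_A = sum_mu fr A mu d/dx^mu, with e^A(E_B) = delta^A_B *)
Definition fr (A mu : nat) (x : R4) : R :=
  let r := x 1%nat in let q := x 2%nat in
  let sC := sqrt (Cr r) in let sD := sqrt (Dq q) in let p := rho r q in
  match A, mu with
  | 0%nat, 0%nat => (r ^ 2 + a ^ 2) / (p * sC)
  | 0%nat, 3%nat => a / (p * sC)
  | 1%nat, 1%nat => sC / p
  | 2%nat, 2%nat => sD / p
  | 3%nat, 0%nat => a * (1 - q ^ 2) / (p * sD)
  | 3%nat, 3%nat => 1 / (p * sD)
  | _, _ => 0
  end.

Definition eta (A : nat) : R := if Nat.eqb A 0 then -1 else 1.

Definition gKerr (mu nu : nat) (x : R4) : R :=
  eta 0 * cof 0 mu x * cof 0 nu x + eta 1 * cof 1 mu x * cof 1 nu x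
  + eta 2 * cof 2 mu x * cof 2 nu x + eta 3 * cof 3 mu x * cof 3 nu x.

Definition gKerrinv (mu nu : nat) (x : R4) : R :=
  eta 0 * fr 0 mu x * fr 0 nu x + eta 1 * fr 1 mu x * fr 1 nu x
  + eta 2 * fr 2 mu x * fr 2 nu x + eta 3 * fr 3 mu x * fr 3 nu x.

Definition lamp (x : R4) : C := (/ (RtoC (x 1%nat) + Ci * RtoC (a * x 2%nat)))%C.

Definition g (mu nu : nat) : Fn := fun x => (lamp x ^ 2 * RtoC (gKerr mu nu x))%C.
Definition ginv (mu nu : nat) : Fn := fun x => (RtoC (gKerrinv mu nu x) / lamp x ^ 2)%C.

Definition Gam (l m n : nat) : Fn := fun x =>
  (/ 2 * sum4 (fun k => ginv l k x * (pd m (g k n) x + pd n (g k m) x - pd k (g m n) x)))%C.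

Definition nabla1 (th : Form1) (m n : nat) : Fn := fun x =>
  (pd m (th n) x - sum4 (fun l => Gam l m n x * th l x))%C.
Definition nabla2 (B : Form2) (m r s : nat) : Fn := fun x =>
  (pd m (B r s) x - sum4 (fun l => Gam l m r x * B l s x)
                  - sum4 (fun l => Gam l m s x * B r l x))%C.
Definition nabla3 (T : Form3) (m p r s : nat) : Fn := fun x =>
  (pd m (T p r s) x - sum4 (fun l => Gam l m p x * T l r s x)
                    - sum4 (fun l => Gam l m r x * T p l s x)
                    - sum4 (fun l => Gam l m s x * T p r l x))%C.

Definition d0 (F : Fn) : Form1 := fun m => pd m F.
Definition d1 (th : Form1) : Form2 := fun m n x => (pd m (th n) x - pd n (th m) x)%C.
Definition d2 (B : Form2) : Form3 := fun m n p x =>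
  (pd m (B n p) x + pd n (B p m) x + pd p (B m n) x)%C.

Definition delta2 (B : Form2) : Form1 := fun n x =>
  (- sum4 (fun m => sum4 (fun k => ginv m k x * nabla2 B k m n x)))%C.
Definition delta3 (T : Form3) : Form2 := fun n p x =>
  (- sum4 (fun m => sum4 (fun k => ginv m k x * nabla3 T k m n p x)))%C.

Definition HodgeLap (B : Form2) : Form2 := fun m n x =>
  (d1 (delta2 B) m n x + delta3 (d2 B) m n x)%C.

(* Levi-Civita symbol, eps 0 1 2 3 = 1, for indices in 0..3 *)
Definition eps4 (i j k l : nat) : R :=
  (INR j - INR i) * (INR k - INR i) * (INR l - INR i) * (INR k - INR j)
  * (INR l - INR j) * (INR l - INR k) / 12.

(* Hodge star on 2-forms, computed in the Kerr orthonormal coframe: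
   (star B)_{AB} = 1/2 eps_{AB}^{CD} B_{CD}; this is the orientation with
   star Sigma^i = i Sigma^i. *)
Definition frame2 (B : Form2) (A0 B0 : nat) : Fn := fun x =>
  sum4 (fun m => sum4 (fun n => RtoC (fr A0 m x * fr B0 n x) * B m n x))%C.
Definition star (B : Form2) : Form2 := fun m n x =>
  sum4 (fun A0 => sum4 (fun B0 => RtoC (cof A0 m x * cof B0 n x) *
     (/ 2 * sum4 (fun C0 => sum4 (fun D0 =>
        RtoC (eps4 A0 B0 C0 D0 * eta C0 * eta D0) * frame2 B C0 D0 x)))))%C.

Definition Pselfdual (B : Form2) : Form2 := fun m n x =>
  (/ 2 * (B m n x - Ci * star B m n x))%C.

Definition dplus (th : Form1) : Form2 := Pselfdual (d1 th).
Definition dplus_star (B : Form2) : Form1 := delta2 (Pselfdual B).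
Definition Oop (B : Form2) : Form2 := fun m n x => (2 * dplus (dplus_star B) m n x)%C.

Definition Ric (m n : nat) : Fn := fun x =>
  (sum4 (fun l => pd l (Gam l m n) x) - sum4 (fun l => pd n (Gam l m l) x)
   + sum4 (fun l => sum4 (fun k => Gam l l k x * Gam k m n x - Gam l n k x * Gam k m l x)))%C.
Definition scal : Fn := fun x => sum4 (fun m => sum4 (fun n => (ginv m n x * Ric m n x)%C)).

Definition wedge (A0 B0 : nat) : Form2 := fun m n x =>
  RtoC (cof A0 m x * cof B0 n x - cof A0 n x * cof B0 m x).
Definition Sigma (i : nat) : Form2 := fun m n x =>
  match i with
  | 1%nat => Ci * wedge 0 1 m n x - wedge 2 3 m n x
  | 2%nat => Ci * wedge 0 2 m n x - wedge 3 1 m n x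
  | _ => Ci * wedge 0 3 m n x - wedge 1 2 m n x
  end%C.
Definition Omega (i : nat) : Form2 := fun m n x => (lamp x ^ 2 * Sigma i m n x)%C.
Definition omega : Form2 := Omega 1.
Definition OmegaP : Form2 := fun m n x =>
  ((Omega 2 m n x + Ci * Omega 3 m n x) / RtoC (sqrt 2))%C.
Definition OmegaM : Form2 := fun m n x =>
  ((Omega 2 m n x - Ci * Omega 3 m n x) / RtoC (sqrt 2))%C.

Definition is_conn_form (Acon : Form1) : Prop :=
  forall x, KerrDom x -> forall m r s, (m < 4)%nat -> (r < 4)%nat -> (s < 4)%nat ->
    (nabla2 OmegaP m r s x + Ci * Acon m x * OmegaP r s x = 0)%C /\
    (nabla2 OmegaM m r s x - Ci * Acon m x * OmegaM r s x = 0)%C.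

Definition boxg (F : Fn) : Fn := fun x =>
  sum4 (fun al => sum4 (fun be => (ginv al be x * nabla1 (d0 F) be al x)%C)).

Definition Ok (k : R) (Acon : Form1) (Psi : Fn) : Fn := fun x =>
  let v : Form1 := fun al y => (pd al Psi y + Ci * RtoC k * Acon al y * Psi y)%C in
  (- (sum4 (fun al => sum4 (fun be => ginv al be x * nabla1 v be al x))
      + Ci * RtoC k * sum4 (fun al => sum4 (fun be => ginv al be x * Acon be x * v al x)))
   + RtoC ((1 + 2 * k ^ 2) / 6) * scal x * Psi x)%C.

End Kerr.

Definition fmul (F : Fn) (B : Form2) : Form2 := fun m n x => (F x * B m n x)%C.
Definition fadd (B1 B2 : Form2) : Form2 := fun m n x => (B1 m n x + B2 m n x)%C.
Definition fneg (F : Fn) : Fn := fun y => (- F y)%C.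

(* Main.v *)
From Stdlib Require Import Reals List ZArith Lra Lia FunctionalExtensionality.
From Coquelicot Require Import Coquelicot.
Require Import Defs.
Open Scope R_scope.

(** Every self-dual 2-form is F = sum_i f_i Om_i with Om_i among omega, Omega^+, Omega^-,
    and nabla Om_i = kap_i Om_i with kap = 0, - i a, i a.  Hence nabla F = sum_i D f_i (x) Om_i
    with D f = df + kap f, and both d delta F and delta d F are algebraic contractions of the
    covariant Hessians H_i = D D f_i with the Om_i.  In the orthonormal frame the Om_i have
    constant components (up to lamp^2), so everything reduces to 4 x 4 constant linear algebra:
    for arbitrary H one finds delta d F = - i star d delta F, which is the first claim, and
    2 P_+ d delta F = sum_i (- tr H_i + curvature) Om_i, where only the antisymmetric part of
    H_i, that is the self-dual part of d kap_i, enters the curvature term.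
    What is left is specific to Kerr and follows from the explicit Christoffel symbols:
    nabla omega = 0, a_r = a_q = 0, P_+ da = (s / 4) omega and s = 12 M lambda_+. *)

(** * Complex field arithmetic and partial derivatives *)

(* With Gaussian-integer coefficients [ring] and [field] know that Ci ^ 2 = -1. *)

(** The obstacle is the size of the coordinate computations: the coframe contains three square roots
    and the metric is complex. The roots cancel from $g$ and from $\omega$, and they enter
    $\Omega^+$ only through the common factor $\sqrt{C D}$. The Christoffel symbols are therefore
    rational functions of [zz], [zb], [cc], [dd], and in most identities $C(r)$ and $C'(r)$ can be
    left as independent symbols; only the curvature needs the explicit quadratic. The connection
    form is not constructed. The hypothesis [is_conn_form] supplies the recurrence of $\Omega^\pm$,
    and one nowhere vanishing component of $\nabla\Omega^+$ identifies the form explicitly. The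
    second-order analysis treats one term $f\,\Omega$ with $\nabla\Omega=\kappa\otimes\Omega$ and
    never opens the Christoffel symbols: it uses only their symmetry and the derivative of the
    inverse metric. Analysis enters through differentiability on an open set and the symmetry of
    second derivatives. *)

Definition gauss := (Z * Z)%type.
Definition gadd (u v : gauss) : gauss := (fst u + fst v, snd u + snd v)%Z.
Definition gsub (u v : gauss) : gauss := (fst u - fst v, snd u - snd v)%Z.
Definition gopp (u : gauss) : gauss := (- fst u, - snd u)%Z.
Definition gmul (u v : gauss) : gauss :=
  (fst u * fst v - snd u * snd v, fst u * snd v + snd u * fst v)%Z.
Definition geqb (u v : gauss) : bool :=
  (Z.eqb (fst u) (fst v) && Z.eqb (snd u) (snd v))%bool.
Definition gphi (u : gauss) : C := (IZR (fst u), IZR (snd u)).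

Lemma gauss_morph :
  ring_morph (RtoC 0) (RtoC 1) Cplus Cmult Cminus Copp (@eq C)
    (0, 0)%Z (1, 0)%Z gadd gmul gsub gopp geqb gphi.
Proof.
  split; try reflexivity; unfold gphi; simpl; intros.
  - unfold Cplus; simpl; now rewrite !plus_IZR.
  - unfold Cminus, Cplus, Copp; simpl; now rewrite !minus_IZR.
  - unfold Cmult; simpl; now rewrite !minus_IZR, !plus_IZR, !mult_IZR.
  - unfold Copp; simpl; now rewrite !opp_IZR.
  - unfold geqb in H. apply andb_prop in H. destruct H as [H1 H2].
    apply Z.eqb_eq in H1. apply Z.eqb_eq in H2. now rewrite H1, H2.
Qed.

Lemma C_power_theory : power_theory (RtoC 1) Cmult (@eq C) N.to_nat Cpow.
Proof.
  split. intros r n. destruct n as [|p]; simpl; [reflexivity|].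
  induction p as [|p IH] using Pos.peano_ind; [ simpl; now rewrite Cmult_1_r |].
  rewrite Pos2Nat.inj_succ; simpl Cpow. rewrite IH.
  rewrite <- (pow_pos_succ (Eqsth C)); [reflexivity| |].
  - intros a b H c d H'; now subst.
  - apply Cmult_assoc.
Qed.

Ltac gauss_cst t :=
  match t with
  | Ci => constr:((0, 1)%Z)
  | RtoC (IZR ?z) => match isZcst z with true => constr:((z, 0%Z)) | _ => constr:(InitialRing.NotConstant) end
  | _ => constr:(InitialRing.NotConstant)
  end.
Ltac cpow_cst t :=
  match isnatcst t with true => eval compute in (N.of_nat t) | _ => constr:(InitialRing.NotConstant) end.

Add Field C_gauss_field : C_field_theory
  (morphism gauss_morph, constants [gauss_cst], power_tac C_power_theory [cpow_cst]).

(** [pd] is total and has some value even where no derivative exists. This relation carries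
    existence along with the value, so that the differentiation rules can be chained. *)
Definition is_pd (mu : nat) (F : Fn) (x : R4) (v : C) : Prop :=
  is_derive (fun s => fst (F (shift x mu s))) 0 (fst v) /\
  is_derive (fun s => snd (F (shift x mu s))) 0 (snd v).

Lemma is_pd_unique mu F x v : is_pd mu F x v -> pd mu F x = v.
Proof.
  intros [H1 H2]. destruct v as [v1 v2]. unfold pd.
  f_equal; apply is_derive_unique; assumption.
Qed.

Lemma shift_0 x mu : shift x mu 0 = x.
Proof. extensionality i. unfold shift. destruct (Nat.eqb i mu); [ring|reflexivity]. Qed.

Lemma shift_comm x mu nu s t : shift (shift x mu s) nu t = shift (shift x nu t) mu s.
Proof.
  extensionality i. unfold shift. destruct (Nat.eqb i nu), (Nat.eqb i mu); ring.
Qed.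
Lemma shift_shift x mu s t : shift (shift x mu s) mu t = shift x mu (s + t).
Proof. extensionality i. unfold shift. destruct (Nat.eqb i mu); ring. Qed.

Lemma is_pd_const mu (c : C) x : is_pd mu (fun _ => c) x 0%C.
Proof. split; simpl; apply @is_derive_const. Qed.

Lemma is_pd_coord mu i x :
  is_pd mu (fun y => RtoC (y i)) x (RtoC (if Nat.eqb i mu then 1 else 0)).
Proof.
  unfold is_pd, shift. destruct (Nat.eqb i mu); simpl; split;
  auto_derive; auto; ring.
Qed.

Lemma is_pd_plus mu F G x u v : is_pd mu F x u -> is_pd mu G x v ->
  is_pd mu (fun y => F y + G y)%C x (u + v)%C.
Proof. intros [H1 H2] [H3 H4]; split; simpl; now apply @is_derive_plus. Qed.

Lemma is_pd_opp mu F x u : is_pd mu F x u -> is_pd mu (fun y => - F y)%C x (- u)%C.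
Proof. intros [H1 H2]; split; simpl; now apply @is_derive_opp. Qed.

Lemma is_pd_minus mu F G x u v : is_pd mu F x u -> is_pd mu G x v ->
  is_pd mu (fun y => F y - G y)%C x (u - v)%C.
Proof. intros; apply is_pd_plus; [|apply is_pd_opp]; assumption. Qed.

Lemma is_pd_mult mu F G x u v : is_pd mu F x u -> is_pd mu G x v ->
  is_pd mu (fun y => F y * G y)%C x (u * G x + F x * v)%C.
Proof.
  intros [H1 H2] [H3 H4]; split; cbn [fst snd Cmult Cplus].
  - evar_last.
    + apply @is_derive_minus; apply @is_derive_mult; eauto; intros; apply Rmult_comm.
    + unfold minus, plus, opp, mult; simpl; rewrite shift_0; ring.
  - evar_last.
    + apply @is_derive_plus; apply @is_derive_mult; eauto; intros; apply Rmult_comm.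
    + unfold minus, plus, opp, mult; simpl; rewrite shift_0; ring.
Qed.

Lemma Cnorm2_neq_0 (z : C) : z <> 0%C -> (fst z ^ 2 + snd z ^ 2 <> 0)%R.
Proof.
  intros Hz H. apply Hz. destruct z as [u v]; simpl in *.
  assert (u = 0) by nra. assert (v = 0) by nra. now subst.
Qed.

Lemma is_pd_inv mu F x u : is_pd mu F x u -> F x <> 0%C ->
  is_pd mu (fun y => / F y)%C x (- u / F x ^ 2)%C.
Proof.
  intros [H1 H2] H0. pose proof (Cnorm2_neq_0 _ H0) as Hn.
  (* Inverting [F x] twice instead of inverting its square leaves the squared modulus of [F x] as
     the only denominator, which [Hn] shows to be nonzero. *)
  assert (E : (- u / F x ^ 2)%C = (- u * (/ F x * / F x))%C) by (field; assumption).
  rewrite E; clear E.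
  assert (Hd : is_derive (fun s => fst (F (shift x mu s)) ^ 2 + snd (F (shift x mu s)) ^ 2) 0
     (2 * fst (F x) * fst u + 2 * snd (F x) * snd u)).
  { evar_last. apply @is_derive_plus; apply is_derive_pow; eauto.
    unfold plus; simpl; rewrite shift_0; ring. }
  split; unfold Cinv; cbn [fst snd Cmult Copp].
  - evar_last.
    + apply is_derive_div; eauto. rewrite shift_0; exact Hn.
    + simpl; rewrite shift_0; field; simpl in Hn |- *; lra.
  - evar_last.
    + apply is_derive_div; [apply @is_derive_opp| |]; eauto. rewrite shift_0; exact Hn.
    + unfold opp; simpl; rewrite shift_0; field; simpl in Hn |- *; lra.
Qed.

Lemma is_pd_div mu F G x u v : is_pd mu F x u -> is_pd mu G x v -> G x <> 0%C ->
  is_pd mu (fun y => F y / G y)%C x ((u * G x - F x * v) / G x ^ 2)%C.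
Proof.
  intros HF HG H0.
  replace ((u * G x - F x * v) / G x ^ 2)%C with (u * / G x + F x * (- v / G x ^ 2))%C
    by (field; assumption).
  apply is_pd_mult; [assumption | now apply is_pd_inv].
Qed.

Lemma is_pd_pow mu F x u n : is_pd mu F x u ->
  is_pd mu (fun y => F y ^ n)%C x (RtoC (INR n) * F x ^ (pred n) * u)%C.
Proof.
  intros H. induction n as [|n IH].
  - simpl. replace (0 * 1 * u)%C with (RtoC 0) by ring. apply is_pd_const.
  - change (is_pd mu (fun y => F y * F y ^ n)%C x (RtoC (INR (S n)) * F x ^ n * u)%C).
    evar_last. apply (is_pd_mult _ _ _ _ _ _ H IH).
    rewrite S_INR, RtoC_plus. destruct n; simpl; ring.
Qed.

Lemma is_pd_sum4 mu (F : nat -> Fn) x v : (forall i, (i < 4)%nat -> is_pd mu (F i) x (v i)) ->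
  is_pd mu (fun y => sum4 (fun i => F i y)) x (sum4 v).
Proof. intros H. unfold sum4. repeat apply is_pd_plus; apply H; lia. Qed.

Lemma is_pd_sqrt mu (f : R4 -> R) x (v : C) :
  is_pd mu (fun y => RtoC (f y)) x v -> 0 < f x ->
  is_pd mu (fun y => RtoC (sqrt (f y))) x (v / (2 * RtoC (sqrt (f x))))%C.
Proof.
  intros [H1 H2] H0. simpl in H1, H2.
  (* The imaginary part of an embedded real function is constantly 0, hence so is its derivative. *)
  assert (Hv : v = RtoC (fst v)).
  { apply is_derive_unique in H2. rewrite Derive_const in H2.
    destruct v as [v1 v2]; simpl in *. now subst. }
  assert (Hs : sqrt (f x) <> 0) by (apply Rgt_not_eq, sqrt_lt_R0, H0).
  rewrite Hv, <- RtoC_mult, <- RtoC_div by lra. split; simpl.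
  - evar_last. apply (is_derive_comp sqrt (fun s => f (shift x mu s))).
    + apply is_derive_sqrt; [apply is_derive_id|]. rewrite shift_0; exact H0.
    + exact H1.
    + unfold Hierarchy.scal, one; simpl; unfold mult; simpl; rewrite shift_0. field; exact Hs.
  - apply @is_derive_const.
Qed.

(** Openness along coordinate lines is what a single partial derivative sees; the mixed derivatives
    below call for full boxes. *)
Definition open4 (U : R4 -> Prop) : Prop := forall x mu, U x ->
  locally 0 (fun s => U (shift x mu s)).

Lemma is_pd_ext (U : R4 -> Prop) mu F G x v : open4 U -> U x ->
  (forall y, U y -> F y = G y) -> is_pd mu F x v -> is_pd mu G x v.
Proof.
  intros HU Hx HFG [H1 H2].
  split; (eapply is_derive_ext_loc; [| eassumption]);
  (eapply filter_imp; [| apply (HU x mu Hx)]); simpl; intros s Hs; now rewrite HFG.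
Qed.

Lemma pd_ext (U : R4 -> Prop) mu F G x : open4 U -> U x ->
  (forall y, U y -> F y = G y) -> pd mu F x = pd mu G x.
Proof.
  intros HU Hx HFG. unfold pd. f_equal; apply Derive_ext_loc;
  (eapply filter_imp; [| apply (HU x mu Hx)]); simpl; intros s Hs; now rewrite HFG.
Qed.

(** * Once and twice differentiable functions on an open set *)

Section Classes.
Variable U : R4 -> Prop.
Hypothesis U_open : open4 U.

Definition C1 (F : Fn) : Prop := forall x mu, U x -> (mu < 4)%nat -> is_pd mu F x (pd mu F x).
(** Symmetry of the second derivatives takes the place of their continuity: it is the consequence
    that the geometry uses, and it passes to sums, products, inverses and roots by algebra alone. *)
Definition C2 (F : Fn) : Prop := C1 F /\ (forall mu, (mu < 4)%nat -> C1 (pd mu F)) /\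
  forall x mu nu, U x -> (mu < 4)%nat -> (nu < 4)%nat -> pd mu (pd nu F) x = pd nu (pd mu F) x.

Lemma C1_intro F G : (forall x mu, U x -> (mu < 4)%nat -> is_pd mu F x (G mu x)) -> C1 F.
Proof. intros H x mu Hx Hm. specialize (H x mu Hx Hm). now rewrite (is_pd_unique _ _ _ _ H). Qed.

Lemma C1_ext F G : (forall y, U y -> F y = G y) -> C1 F -> C1 G.
Proof.
  intros H HF x mu Hx Hm. rewrite <- (pd_ext U mu F G x U_open Hx H).
  apply (is_pd_ext U mu F G); auto.
Qed.

(** The gradient formula [G] is valid only on [U]; since [U] is open along coordinate lines, it may
    still be substituted under an outer derivative. *)
Lemma C2_intro F G : (forall x mu, U x -> (mu < 4)%nat -> is_pd mu F x (G mu x)) ->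
  (forall mu, (mu < 4)%nat -> C1 (G mu)) ->
  (forall x mu nu, U x -> (mu < 4)%nat -> (nu < 4)%nat -> pd mu (G nu) x = pd nu (G mu) x) ->
  C2 F.
Proof.
  intros HF HG Hs.
  assert (E : forall mu, (mu < 4)%nat -> forall y, U y -> G mu y = pd mu F y)
    by (intros; symmetry; now apply is_pd_unique, HF).
  split; [|split].
  - now apply C1_intro with G.
  - intros mu Hm. apply C1_ext with (G mu); auto.
  - intros x mu nu Hx Hm Hn.
    rewrite <- (pd_ext U mu (G nu) _ x U_open Hx (E nu Hn)).
    rewrite <- (pd_ext U nu (G mu) _ x U_open Hx (E mu Hm)). now apply Hs.
Qed.

Lemma C1_const c : C1 (fun _ => c).
Proof. apply C1_intro with (fun _ _ => 0%C). intros; apply is_pd_const. Qed.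
Lemma C1_plus F G : C1 F -> C1 G -> C1 (fun y => F y + G y)%C.
Proof.
  intros HF HG. apply (C1_intro _ (fun mu y => pd mu F y + pd mu G y)%C).
  intros; apply is_pd_plus; auto.
Qed.
Lemma C1_mult F G : C1 F -> C1 G -> C1 (fun y => F y * G y)%C.
Proof.
  intros HF HG. apply (C1_intro _ (fun mu y => pd mu F y * G y + F y * pd mu G y)%C).
  intros; apply is_pd_mult; auto.
Qed.
Lemma C1_inv F : C1 F -> (forall y, U y -> F y <> 0%C) -> C1 (fun y => / F y)%C.
Proof.
  intros HF H0. apply (C1_intro _ (fun mu y => - pd mu F y / F y ^ 2)%C).
  intros; apply is_pd_inv; auto.
Qed.
Lemma C1_opp F : C1 F -> C1 (fun y => - F y)%C.
Proof.
  intros HF. apply (C1_intro _ (fun mu y => - pd mu F y)%C). intros; apply is_pd_opp; auto.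
Qed.
Lemma C1_sum4 (F : nat -> Fn) : (forall i, (i < 4)%nat -> C1 (F i)) ->
  C1 (fun y => sum4 (fun i => F i y)).
Proof.
  intros H. apply (C1_intro _ (fun mu y => sum4 (fun i => pd mu (F i) y))).
  intros. apply is_pd_sum4; intros; apply H; auto.
Qed.

Lemma pd_plus F G x mu : C1 F -> C1 G -> U x -> (mu < 4)%nat ->
  pd mu (fun y => F y + G y)%C x = (pd mu F x + pd mu G x)%C.
Proof. intros; apply is_pd_unique, is_pd_plus; auto. Qed.
Lemma pd_opp F x mu : C1 F -> U x -> (mu < 4)%nat ->
  pd mu (fun y => - F y)%C x = (- pd mu F x)%C.
Proof. intros; apply is_pd_unique, is_pd_opp; auto. Qed.
Lemma pd_mult F G x mu : C1 F -> C1 G -> U x -> (mu < 4)%nat ->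
  pd mu (fun y => F y * G y)%C x = (pd mu F x * G x + F x * pd mu G x)%C.
Proof. intros; apply is_pd_unique, is_pd_mult; auto. Qed.
Lemma pd_inv F x mu : C1 F -> U x -> F x <> 0%C -> (mu < 4)%nat ->
  pd mu (fun y => / F y)%C x = (- pd mu F x / F x ^ 2)%C.
Proof. intros; apply is_pd_unique, is_pd_inv; auto. Qed.
Lemma pd_sum4 (F : nat -> Fn) x mu : (forall i, (i < 4)%nat -> C1 (F i)) -> U x -> (mu < 4)%nat ->
  pd mu (fun y => sum4 (fun i => F i y)) x = sum4 (fun i => pd mu (F i) x).
Proof. intros H ? ?; apply is_pd_unique, is_pd_sum4; intros; apply H; auto. Qed.

Lemma C2_C1 F : C2 F -> C1 F. Proof. now intros []. Qed.
Lemma C2_pd F mu : C2 F -> (mu < 4)%nat -> C1 (pd mu F). Proof. intros [_ [H _]] ?; auto. Qed.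
Lemma C2_sym F : C2 F -> forall x mu nu, U x -> (mu < 4)%nat -> (nu < 4)%nat ->
  pd mu (pd nu F) x = pd nu (pd mu F) x.
Proof. now intros [_ [_ H]]. Qed.

Lemma C2_const c : C2 (fun _ => c).
Proof.
  apply C2_intro with (fun _ _ => 0%C); intros.
  - apply is_pd_const. - apply C1_const. - reflexivity.
Qed.
Lemma C2_coord i : C2 (fun y => RtoC (y i)).
Proof.
  apply C2_intro with (fun mu _ => RtoC (if Nat.eqb i mu then 1 else 0)); intros.
  - apply is_pd_coord. - apply C1_const.
  - erewrite 2!is_pd_unique; [reflexivity| |]; apply is_pd_const.
Qed.
Lemma C2_plus F G : C2 F -> C2 G -> C2 (fun y => F y + G y)%C.
Proof.
  intros HF HG. apply C2_intro with (fun mu y => pd mu F y + pd mu G y)%C; intros.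
  - apply is_pd_plus; apply C2_C1; auto.
  - apply C1_plus; apply C2_pd; auto.
  - rewrite !pd_plus; auto using C2_pd. f_equal; apply C2_sym; auto.
Qed.
Lemma C2_mult F G : C2 F -> C2 G -> C2 (fun y => F y * G y)%C.
Proof.
  intros HF HG. apply C2_intro with (fun mu y => pd mu F y * G y + F y * pd mu G y)%C; intros.
  - apply is_pd_mult; apply C2_C1; auto.
  - apply C1_plus; apply C1_mult; auto using C2_pd, C2_C1.
  - rewrite !pd_plus, !pd_mult; auto using C2_pd, C2_C1, C1_mult.
    rewrite (C2_sym F HF x mu nu), (C2_sym G HG x mu nu) by auto. ring.
Qed.
Lemma C2_inv F : C2 F -> (forall y, U y -> F y <> 0%C) -> C2 (fun y => / F y)%C.
Proof.
  intros HF H0. pose proof (C2_C1 _ HF) as HF1.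
  assert (HI : C1 (fun y => / F y)%C) by now apply C1_inv.
  apply C2_intro with (fun mu y => (- pd mu F y) * (/ F y * / F y))%C; intros.
  - replace (- pd mu F x * (/ F x * / F x))%C with (- pd mu F x / F x ^ 2)%C
      by (field; auto). apply is_pd_inv; auto.
  - auto using C1_mult, C1_opp, C2_pd.
  - rewrite !pd_mult, !pd_opp, !pd_inv; auto using C1_mult, C1_opp, C2_pd.
    rewrite (C2_sym F HF x mu nu) by auto. field; auto.
Qed.
(** With $w=\sqrt f$ one has $\partial w=\partial f/(2w)$. A second derivative thus involves only
    $w$ and derivatives of $f$, and the resulting expression is visibly symmetric. *)
Lemma C2_sqrt (f : R4 -> R) : C2 (fun y => RtoC (f y)) -> (forall y, U y -> 0 < f y) ->
  C2 (fun y => RtoC (sqrt (f y))).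
Proof.
  intros HF H0. pose proof (C2_C1 _ HF) as HF1.
  set (w := fun y => RtoC (sqrt (f y))).
  assert (Hw : forall y, U y -> w y <> 0%C).
  { intros y Hy E. apply RtoC_inj in E. revert E. apply Rgt_not_eq, sqrt_lt_R0, H0, Hy. }
  set (F := fun y => RtoC (f y)) in *.
  assert (Hp : forall x mu, U x -> (mu < 4)%nat -> is_pd mu w x (pd mu F x * / (2 * w x))%C)
    by (intros; apply is_pd_sqrt; auto; apply HF1; auto).
  assert (H1 : C1 w) by (eapply C1_intro; exact Hp).
  assert (H2 : C1 (fun y => / (2 * w y))%C).
  { apply C1_inv. apply C1_mult; auto using C1_const.
    intros y Hy. apply Cmult_neq_0; auto. intro E; apply RtoC_inj in E; lra. }
  assert (N2 : RtoC 2 <> RtoC 0) by (intro E; apply RtoC_inj in E; lra).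
  apply C2_intro with (fun mu y => pd mu F y * / (2 * w y))%C; auto.
  - auto using C1_mult, C2_pd.
  - intros. rewrite !pd_mult; auto using C2_pd.
    rewrite !pd_inv; auto using C1_mult, C1_const; try (apply Cmult_neq_0; auto).
    rewrite !pd_mult; auto using C1_const.
    rewrite (is_pd_unique _ _ _ _ (Hp x mu H H3)), (is_pd_unique _ _ _ _ (Hp x nu H H4)).
    rewrite (C2_sym F HF x mu nu) by auto.
    rewrite 2!(is_pd_unique _ _ _ _ (is_pd_const _ _ _)). field. auto.
Qed.
Lemma C2_ext F G : (forall y, U y -> F y = G y) -> C2 F -> C2 G.
Proof.
  intros H HF. apply C2_intro with (fun mu => pd mu F); intros.
  - apply (is_pd_ext U mu F G); auto. apply C2_C1; auto.
  - auto using C2_pd.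
  - apply C2_sym; auto.
Qed.
Lemma C2_opp F : C2 F -> C2 (fun y => - F y)%C.
Proof.
  intros HF. apply C2_ext with (fun y => (-1) * F y)%C; [intros; ring|].
  apply C2_mult; auto using C2_const.
Qed.
Lemma C2_sum4 (F : nat -> Fn) : (forall i, (i < 4)%nat -> C2 (F i)) ->
  C2 (fun y => sum4 (fun i => F i y)).
Proof. intros H. unfold sum4. apply C2_plus; [apply C2_plus; [apply C2_plus|]|]; apply H; lia. Qed.

Lemma C2_minus F G : C2 F -> C2 G -> C2 (fun y => F y - G y)%C.
Proof. intros. apply C2_plus; [assumption|now apply C2_opp]. Qed.
Lemma C2_div F G : C2 F -> C2 G -> (forall y, U y -> G y <> 0%C) -> C2 (fun y => F y / G y)%C.
Proof. intros. apply C2_mult; [assumption|now apply C2_inv]. Qed.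
Lemma C2_pow F n : C2 F -> C2 (fun y => F y ^ n)%C.
Proof.
  intros HF. induction n; simpl; [apply C2_const|now apply C2_mult].
Qed.
End Classes.

(** * Symmetry of second derivatives *)

(** The neighbourhoods are those of [cont_at]: a point is a function on all of [nat], and only its
    first four values are constrained. *)
Definition box_open (U : R4 -> Prop) : Prop := forall x, U x -> exists delta, 0 < delta /\
  forall y : R4, (forall i, (i < 4)%nat -> Rabs (y i - x i) < delta) -> U y.

Lemma box_open_open4 U : box_open U -> open4 U.
Proof.
  intros HU x mu Hx. destruct (HU x Hx) as [d [Hd H]].
  exists (mkposreal d Hd). intros s Hs. apply H. intros i _.
  unfold ball in Hs; simpl in Hs; unfold AbsRing_ball, abs, minus, plus, opp in Hs; simpl in Hs.
  unfold shift. destruct (Nat.eqb i mu).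
  - replace (x i + s - x i) with (s + - 0) by ring. exact Hs.
  - replace (x i - x i) with 0 by ring. now rewrite Rabs_R0.
Qed.

Lemma Derive_translate (k : R -> R) u : Derive (fun s => k (u + s)) 0 = Derive k u.
Proof.
  unfold Derive. f_equal. apply Lim_ext. intros h. now rewrite Rplus_0_l, Rplus_0_r.
Qed.

Lemma ex_derive_translate (k : R -> R) u : ex_derive (fun s => k (u + s)) 0 -> ex_derive k u.
Proof.
  intros H. apply ex_derive_ext with (fun t => k (u + (t - u))).
  - intros t. f_equal. ring.
  - apply (ex_derive_comp (fun s => k (u + s)) (fun t => t - u)).
    + now replace (u - u) with 0 by ring.
    + auto_derive; auto.
Qed.

Section Schwarz_components.
Variable p : C -> R.
Hypothesis p_pd : forall mu F y, p (pd mu F y) = Derive (fun s => p (F (shift y mu s))) 0.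
Hypothesis p_minus : forall z w, p (z - w)%C = p z - p w.
Hypothesis p_le : forall z, Rabs (p z) <= Cmod z.

(** Schwarz's theorem in two real variables, applied on the plane through [x] in the directions [mu]
    and [nu]. The projection [p] stands for the real or the imaginary part, so that one argument
    serves both. *)
Lemma pd_comm_component (U : R4 -> Prop) (F : Fn) x mu nu : box_open U -> U x -> mu <> nu ->
  (mu < 4)%nat -> (nu < 4)%nat ->
  (forall y k, U y -> (k < 4)%nat -> ex_derive (fun s => p (F (shift y k s))) 0) ->
  (forall y k l, U y -> (k < 4)%nat -> (l < 4)%nat -> ex_derive (fun s => p (pd l F (shift y k s))) 0) ->
  (forall y k l, U y -> (k < 4)%nat -> (l < 4)%nat -> cont_at (pd k (pd l F)) y) ->
  p (pd mu (pd nu F) x) = p (pd nu (pd mu F) x).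
Proof.
  intros HU Hx Hmn Hm Hn E1 E2 Cc.
  set (X := fun u v => shift (shift x mu u) nu v).
  assert (X1 : forall u v s, shift (X u v) mu s = X (u + s) v).
  { intros. unfold X. rewrite shift_comm, shift_shift. reflexivity. }
  assert (X2 : forall u v s, shift (X u v) nu s = X u (v + s)).
  { intros. unfold X. now rewrite shift_shift. }
  assert (X0 : X 0 0 = x) by (unfold X; now rewrite !shift_0).
  set (f := fun u v => p (F (X u v))).
  assert (D1 : forall u v, Derive (fun z => f z v) u = p (pd mu F (X u v))).
  { intros. rewrite p_pd. rewrite <- Derive_translate. apply Derive_ext. intros t.
    unfold f. now rewrite X1. }
  assert (D2 : forall u v, Derive (fun z => f u z) v = p (pd nu F (X u v))).
  { intros. rewrite p_pd. rewrite <- Derive_translate. apply Derive_ext. intros t.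
    unfold f. now rewrite X2. }
  assert (D12 : forall u v, Derive (fun z => Derive (fun t => f z t) v) u = p (pd mu (pd nu F) (X u v))).
  { intros. rewrite p_pd. rewrite <- Derive_translate. apply Derive_ext. intros t.
    rewrite D2. now rewrite X1. }
  assert (D21 : forall u v, Derive (fun z => Derive (fun t => f t z) u) v = p (pd nu (pd mu F) (X u v))).
  { intros. rewrite p_pd. rewrite <- Derive_translate. apply Derive_ext. intros t.
    rewrite D1. now rewrite X2. }
  assert (Hbox : forall d, 0 < d -> forall u v, Rabs (u - 0) < d -> Rabs (v - 0) < d ->
            forall i, (i < 4)%nat -> Rabs (X u v i - x i) < d).
  { intros d Hd u v Hu Hv i _. unfold X, shift.
    destruct (Nat.eqb_spec i nu), (Nat.eqb_spec i mu).
    - exfalso. apply Hmn. congruence.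
    - now replace (x i + v - x i) with (v - 0) by ring.
    - now replace (x i + u - x i) with (u - 0) by ring.
    - replace (x i - x i) with 0 by ring. now rewrite Rabs_R0. }
  assert (Hc : forall k l, (k < 4)%nat -> (l < 4)%nat ->
     continuity_2d_pt (fun u v => p (pd k (pd l F) (X u v))) 0 0).
  { intros k l Hk Hl eps. destruct (Cc x k l Hx Hk Hl eps (cond_pos eps)) as [d [Hd H]].
    exists (mkposreal d Hd). intros u v Hu Hv. rewrite X0, <- p_minus.
    eapply Rle_lt_trans; [apply p_le|]. apply H. now apply Hbox. }
  rewrite <- X0, <- D12, <- D21. apply Schwarz.
  - destruct (HU x Hx) as [d [Hd H]]. exists (mkposreal d Hd). intros u v Hu Hv.
    assert (HX : U (X u v)) by (apply H; now apply Hbox).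
    split; [|split; [|split]].
    + apply ex_derive_translate. eapply ex_derive_ext; [|apply (E1 (X u v) mu HX Hm)].
      intros; simpl; unfold f; now rewrite X1.
    + apply ex_derive_translate. eapply ex_derive_ext; [|apply (E1 (X u v) nu HX Hn)].
      intros; simpl; unfold f; now rewrite X2.
    + apply ex_derive_translate. eapply ex_derive_ext; [|apply (E2 (X u v) mu nu HX Hm Hn)].
      intros; simpl. now rewrite D2, X1.
    + apply ex_derive_translate. eapply ex_derive_ext; [|apply (E2 (X u v) nu mu HX Hn Hm)].
      intros; simpl. now rewrite D1, X2.
  - intros eps. destruct (Hc mu nu Hm Hn eps) as [d H]. exists d.
    intros u v Hu Hv. rewrite !D12. now apply H.
  - intros eps. destruct (Hc nu mu Hn Hm eps) as [d H]. exists d.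
    intros u v Hu Hv. rewrite !D21. now apply H.
Qed.
End Schwarz_components.

Lemma Rabs_fst_le_Cmod z : Rabs (fst z) <= Cmod z.
Proof. eapply Rle_trans; [|apply Rmax_Cmod]. apply Rmax_l. Qed.
Lemma Rabs_snd_le_Cmod z : Rabs (snd z) <= Cmod z.
Proof. eapply Rle_trans; [|apply Rmax_Cmod]. apply Rmax_r. Qed.

Lemma smooth_on_C2 U F : box_open U -> smooth_on U F -> C2 U F.
Proof.
  intros HU HF.
  assert (L0 : List.Forall (fun mu => (mu < 4)%nat) nil) by constructor.
  assert (L1 : forall l, (l < 4)%nat -> List.Forall (fun mu => (mu < 4)%nat) (l :: nil))
    by (intros; repeat (apply List.Forall_cons; [assumption|]); apply List.Forall_nil).
  assert (L2 : forall k l, (k < 4)%nat -> (l < 4)%nat ->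
     List.Forall (fun mu => (mu < 4)%nat) (k :: l :: nil)) by (intros; repeat (apply List.Forall_cons; [assumption|]); apply List.Forall_nil).
  split; [|split].
  - intros x mu Hx Hm. destruct (proj2 (HF nil L0 x Hx) mu Hm) as [H1 H2].
    split; apply Derive_correct; assumption.
  - intros nu Hn x mu Hx Hm. destruct (proj2 (HF (nu :: nil) (L1 nu Hn) x Hx) mu Hm) as [H1 H2].
    split; apply Derive_correct; assumption.
  (* Equal directions are split off because they do not span a plane. *)
  - intros x mu nu Hx Hm Hn. destruct (Nat.eq_dec mu nu) as [->|Hmn]; [reflexivity|].
    apply injective_projections.
    + apply (pd_comm_component fst) with U; auto.
      * apply Rabs_fst_le_Cmod.
      * intros y k Hy Hk. apply (proj2 (HF nil L0 y Hy) k Hk).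
      * intros y k l Hy Hk Hl. apply (proj2 (HF (l :: nil) (L1 l Hl) y Hy) k Hk).
      * intros y k l Hy Hk Hl. apply (proj1 (HF (k :: l :: nil) (L2 k l Hk Hl) y Hy)).
    + apply (pd_comm_component snd) with U; auto.
      * apply Rabs_snd_le_Cmod.
      * intros y k Hy Hk. apply (proj2 (HF nil L0 y Hy) k Hk).
      * intros y k l Hy Hk Hl. apply (proj2 (HF (l :: nil) (L1 l Hl) y Hy) k Hk).
      * intros y k l Hy Hk Hl. apply (proj1 (HF (k :: l :: nil) (L2 k l Hk Hl) y Hy)).
Qed.

Lemma continuity_2d_pt_pos f x y : continuity_2d_pt f x y -> 0 < f x y ->
  locally_2d (fun u v => 0 < f u v) x y.
Proof.
  intros H H0. destruct (H (mkposreal _ H0)) as [d Hd]. exists d. intros u v Hu Hv.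
  specialize (Hd u v Hu Hv). simpl in Hd. apply Rabs_def2 in Hd. lra.
Qed.

(** The domain is cut out by four strict polynomial inequalities in $r$ and $q$ alone, so continuity
    in two variables suffices. *)
Lemma KerrDom_box_open M a : box_open (KerrDom M a).
Proof.
  intros x [HC [HD HR]].
  assert (L : locally_2d (fun u v => 0 < Cr M a u /\ 0 < 1 + v /\ 0 < 1 - v /\ 0 < rho2 a u v)
     (x 1%nat) (x 2%nat)).
  { repeat apply locally_2d_and;
      [apply (continuity_2d_pt_pos (fun u v => Cr M a u))
      |apply (continuity_2d_pt_pos (fun u v => 1 + v))
      |apply (continuity_2d_pt_pos (fun u v => 1 - v))
      |apply (continuity_2d_pt_pos (fun u v => rho2 a u v))]; try lra; auto;
    unfold Cr, rho2; simpl; unfold Rminus;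
    repeat first [ apply continuity_2d_pt_const | apply continuity_2d_pt_id1
                 | apply continuity_2d_pt_id2 | apply continuity_2d_pt_plus
                 | apply continuity_2d_pt_mult | apply continuity_2d_pt_opp ]. }
  destruct L as [d Hd]. exists d. split; [apply cond_pos|].
  intros y Hy. destruct (Hd (y 1%nat) (y 2%nat)) as [H1 [H2 [H3 H4]]].
  - apply Hy; lia. - apply Hy; lia.
  - repeat split; auto; lra.
Qed.

Lemma KerrDom_open4 M a : open4 (KerrDom M a).
Proof. apply box_open_open4, KerrDom_box_open. Qed.

(** * Tactics and four-index matrix algebra *)

Ltac C2_tac := try assumption; lazymatch goal with
  | |- C2 ?V (fun y => Cplus (@?F y) (@?G y)) => apply (C2_plus V ltac:(assumption) F G); C2_tac
  | |- C2 ?V (fun y => Cminus (@?F y) (@?G y)) => apply (C2_minus V ltac:(assumption) F G); C2_tac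
  | |- C2 ?V (fun y => Cmult (@?F y) (@?G y)) => apply (C2_mult V ltac:(assumption) F G); C2_tac
  | |- C2 ?V (fun y => Cdiv (@?F y) (@?G y)) => apply (C2_div V ltac:(assumption) F G); [C2_tac|C2_tac|]
  | |- C2 ?V (fun y => Copp (@?F y)) => apply (C2_opp V ltac:(assumption) F); C2_tac
  | |- C2 ?V (fun y => Cpow (@?F y) ?n) => apply (C2_pow V ltac:(assumption) F n); C2_tac
  | |- C2 ?V (fun y => RtoC (y ?i)) => apply (C2_coord V ltac:(assumption) i)
  | |- C2 ?V (fun _ => ?c) => apply (C2_const V ltac:(assumption) c)
  | |- C2 ?V (fun y => ?F y) => change (fun y => F y) with F; C2_tac
  | |- _ => idtac
  end.

Ltac cases4 m := destruct m as [|[|[|[|m]]]]; [| | | |exfalso; lia].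

Ltac fieldC := field; repeat split; auto;
  try (let E := fresh in intro E; injection E; simpl; intros; lra).

Lemma RtoC_neq_0 (u : R) : u <> 0 -> RtoC u <> RtoC 0.
Proof. intros H E. now apply RtoC_inj in E. Qed.

Lemma two_neq_0 : RtoC 2 <> RtoC 0.
Proof. apply RtoC_neq_0. lra. Qed.

Definition dl (i j : nat) : C := RtoC (if Nat.eqb i j then 1 else 0).

Lemma sum4_ext (f h : nat -> C) : (forall i, (i < 4)%nat -> f i = h i) -> sum4 f = sum4 h.
Proof. intros H. unfold sum4. rewrite !H by lia. reflexivity. Qed.

(** This is $dI=-I\,dG\,I$: multiply $dI\,G+I\,dG=0$ by $I$ on the right and use $G\,I=1$. The
    derivatives are plain matrices here, so no analysis is involved. *)
Lemma deriv_inverse_matrix (I G dI dG : nat -> nat -> C) :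
  (forall k j, (k < 4)%nat -> (j < 4)%nat -> sum4 (fun n => G k n * I n j)%C = dl k j) ->
  (forall l n, (l < 4)%nat -> (n < 4)%nat -> sum4 (fun k => dI l k * G k n + I l k * dG k n)%C = RtoC 0) ->
  forall l j, (l < 4)%nat -> (j < 4)%nat ->
  dI l j = (- sum4 (fun k => sum4 (fun n => I l k * dG k n * I n j)))%C.
Proof.
  intros H1 H2 l j Hl Hj.
  transitivity (sum4 (fun k => dI l k * sum4 (fun n => G k n * I n j)))%C.
  { transitivity (sum4 (fun k => dI l k * dl k j))%C.
    - cases4 j; unfold sum4, dl; cbn [Nat.eqb]; ring.
    - apply sum4_ext. intros. now rewrite H1. }
  transitivity (sum4 (fun n => sum4 (fun k => dI l k * G k n + I l k * dG k n) * I n j)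
     - sum4 (fun k => sum4 (fun n => I l k * dG k n * I n j)))%C.
  { unfold sum4; ring. }
  rewrite (sum4_ext _ (fun _ => RtoC 0)); [unfold sum4; ring|].
  intros. rewrite H2 by auto. ring.
Qed.

(** * Constant-coefficient algebra in the orthonormal frame *)

Definition starF (y : nat -> nat -> C) (A B : nat) : C :=
  (/ 2 * sum4 (fun C0 => sum4 (fun D0 => RtoC (eps4 A B C0 D0 * eta C0 * eta D0) * y C0 D0)))%C.
(** At most two of the sixteen terms of the Levi-Civita contraction survive for each pair of
    indices. Tabulating them, with the signs of the Lorentzian signature, keeps the later [field]
    goals small. *)
Definition starT (y : nat -> nat -> C) (A B : nat) : C :=
  (/ 2 * match A, B with
  | 0%nat, 1%nat => y 2%nat 3%nat - y 3%nat 2%nat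
  | 1%nat, 0%nat => y 3%nat 2%nat - y 2%nat 3%nat
  | 0%nat, 2%nat => y 3%nat 1%nat - y 1%nat 3%nat
  | 2%nat, 0%nat => y 1%nat 3%nat - y 3%nat 1%nat
  | 0%nat, 3%nat => y 1%nat 2%nat - y 2%nat 1%nat
  | 3%nat, 0%nat => y 2%nat 1%nat - y 1%nat 2%nat
  | 2%nat, 3%nat => y 1%nat 0%nat - y 0%nat 1%nat
  | 3%nat, 2%nat => y 0%nat 1%nat - y 1%nat 0%nat
  | 3%nat, 1%nat => y 2%nat 0%nat - y 0%nat 2%nat
  | 1%nat, 3%nat => y 0%nat 2%nat - y 2%nat 0%nat
  | 1%nat, 2%nat => y 3%nat 0%nat - y 0%nat 3%nat
  | 2%nat, 1%nat => y 0%nat 3%nat - y 3%nat 0%nat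
  | _, _ => RtoC 0
  end)%C.

Lemma starF_starT y A B : (A < 4)%nat -> (B < 4)%nat -> starF y A B = starT y A B.
Proof.
  intros HA HB. unfold starF, starT. f_equal. unfold sum4.
  cases4 A; cases4 B;
  repeat match goal with |- context [RtoC (eps4 ?i ?j ?k ?l * eta ?k * eta ?l)] =>
    first [ replace (eps4 i j k l * eta k * eta l) with 0 by (unfold eps4, eta; simpl; lra)
          | replace (eps4 i j k l * eta k * eta l) with 1 by (unfold eps4, eta; simpl; lra)
          | replace (eps4 i j k l * eta k * eta l) with (-1) by (unfold eps4, eta; simpl; lra) ] end;
  ring.
Qed.

Lemma starF_ext y y' A B : (forall C0 D0, (C0 < 4)%nat -> (D0 < 4)%nat -> y C0 D0 = y' C0 D0) ->
  starF y A B = starF y' A B.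
Proof.
  intros H. unfold starF. f_equal. apply sum4_ext; intros; apply sum4_ext; intros. now rewrite H.
Qed.

(* The frame components of c1 Sigma^1 + c2 Sigma^2 + c3 Sigma^3. *)
Definition Sf (c1 c2 c3 : C) (A B : nat) : C :=
  match A, B with
  | 0%nat, 1%nat => Ci * c1 | 1%nat, 0%nat => - (Ci * c1)
  | 0%nat, 2%nat => Ci * c2 | 2%nat, 0%nat => - (Ci * c2)
  | 0%nat, 3%nat => Ci * c3 | 3%nat, 0%nat => - (Ci * c3)
  | 2%nat, 3%nat => - c1 | 3%nat, 2%nat => c1
  | 3%nat, 1%nat => - c2 | 1%nat, 3%nat => c2
  | 1%nat, 2%nat => - c3 | 2%nat, 1%nat => c3
  | _, _ => RtoC 0
  end%C.

Definition etaC (A : nat) : C := RtoC (eta A).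

(* When [h] is the covariant Hessian of f, these are the frame components of d delta (f S) and
   delta d (f S). *)
Definition curlF (h S : nat -> nat -> C) (A B : nat) : C :=
  (- sum4 (fun D => etaC D * (h A D * S D B - h B D * S D A)))%C.
Definition divF (h S : nat -> nat -> C) (A B : nat) : C :=
  (- sum4 (fun D => etaC D * (h D D * S A B + h D A * S B D + h D B * S D A)))%C.

(** The pointwise form of a duality: $\delta$ is $\star d\star$ up to sign, and $\star F={\rm i}F$
    turns $\delta F$ into a multiple of $\star dF$, so that $\star d\delta F$ is a multiple of
    $\delta dF$. *)
Lemma divF_star_curlF h c1 c2 c3 A B : (A < 4)%nat -> (B < 4)%nat ->
  (- Ci * starT (curlF h (Sf c1 c2 c3)) A B = divF h (Sf c1 c2 c3) A B)%C.
Proof.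
  intros HA HB. pose proof two_neq_0.
  cases4 A; cases4 B; unfold starT, curlF, divF, sum4, etaC, eta; cbn [Nat.eqb Sf]; field; auto.
Qed.

(** A trace-free symmetric tensor composed with a self-dual form antisymmetrises to an
    anti-self-dual form: $S_+^2\otimes S_-^2\otimes S_+^2$ contains $S_-^2$ but not $S_+^2$.
    Applying $2P_+=1-{\rm i}\star$ leaves only the trace. *)
Lemma curlF_symmetric h A B : (A < 4)%nat -> (B < 4)%nat ->
  (forall i j, (i < 4)%nat -> (j < 4)%nat -> h i j = h j i) ->
  (curlF h (Sf 1 0 0) A B - Ci * starT (curlF h (Sf 1 0 0)) A B
   = - sum4 (fun D => etaC D * h D D) * Sf 1 0 0 A B)%C.
Proof.
  intros HA HB Hh. pose proof two_neq_0.
  cases4 A; cases4 B; unfold starT, curlF, sum4, etaC, eta; cbn [Nat.eqb Sf];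
  rewrite ?(Hh 1%nat 0%nat), ?(Hh 2%nat 0%nat), ?(Hh 3%nat 0%nat), ?(Hh 2%nat 1%nat),
    ?(Hh 3%nat 1%nat), ?(Hh 3%nat 2%nat) by lia; field; auto.
Qed.

(** The symmetric part of [h] contributes its trace as before. The antisymmetric part acts by
    commutator: its anti-self-dual component commutes with self-dual forms, and its self-dual
    component lies along $\Sigma^1$ by the last three hypotheses. The form $\Sigma^2+e\,{\rm
    i}\Sigma^3$ is an eigenvector of the commutator with $\Sigma^1$, with an eigenvalue proportional
    to $e$; the factor $e$ in front of [t] compensates this sign. *)
Lemma curlF_charged (e : C) h psi c t A B : (A < 4)%nat -> (B < 4)%nat ->
  e = RtoC 1 \/ e = RtoC (-1) ->
  (forall i j, (i < 4)%nat -> (j < 4)%nat -> (h i j - h j i = psi i j)%C) ->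
  (psi 0%nat 1%nat - Ci * psi 2%nat 3%nat = e * t)%C ->
  (psi 0%nat 2%nat - Ci * psi 3%nat 1%nat = 0)%C ->
  (psi 0%nat 3%nat - Ci * psi 1%nat 2%nat = 0)%C ->
  (curlF h (Sf 0 c (e * Ci * c)) A B - Ci * starT (curlF h (Sf 0 c (e * Ci * c))) A B
   = (- sum4 (fun D => etaC D * h D D) + t) * Sf 0 c (e * Ci * c) A B)%C.
Proof.
  intros HA HB He Hh H1 H2 H3. pose proof two_neq_0.
  (* The three conditions are solved for the entries [h 0 j]; all other entries of [h] then remain
     free variables for [field]. *)
  assert (E1 : h 0%nat 1%nat = (h 1%nat 0%nat + Ci * (h 2%nat 3%nat - h 3%nat 2%nat) + e * t)%C).
  { rewrite (Hh 2%nat 3%nat) by lia. rewrite <- H1, <- (Hh 0%nat 1%nat) by lia. ring. }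
  assert (E2 : h 0%nat 2%nat = (h 2%nat 0%nat + Ci * (h 3%nat 1%nat - h 1%nat 3%nat))%C).
  { rewrite (Hh 3%nat 1%nat) by lia.
    transitivity (h 2%nat 0%nat + Ci * psi 3%nat 1%nat + (psi 0%nat 2%nat - Ci * psi 3%nat 1%nat))%C;
    [rewrite <- (Hh 0%nat 2%nat) by lia; ring | rewrite H2; ring]. }
  assert (E3 : h 0%nat 3%nat = (h 3%nat 0%nat + Ci * (h 1%nat 2%nat - h 2%nat 1%nat))%C).
  { rewrite (Hh 1%nat 2%nat) by lia.
    transitivity (h 3%nat 0%nat + Ci * psi 1%nat 2%nat + (psi 0%nat 3%nat - Ci * psi 1%nat 2%nat))%C;
    [rewrite <- (Hh 0%nat 3%nat) by lia; ring | rewrite H3; ring]. }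
  destruct He as [-> | ->];
  cases4 A; cases4 B; unfold starT, curlF, sum4, etaC, eta; cbn [Nat.eqb Sf];
  rewrite ?E1, ?E2, ?E3; field; auto.
Qed.

Lemma Sf_selfdual c1 c2 c3 A B : (A < 4)%nat -> (B < 4)%nat ->
  (- Ci * starT (Sf c1 c2 c3) A B = Sf c1 c2 c3 A B)%C.
Proof.
  intros HA HB. pose proof two_neq_0.
  cases4 A; cases4 B; unfold starT; cbn [Sf]; field; auto.
Qed.

(** A self-dual form is determined by its entries [0 j]. The factor [- Ci] inverts the [Ci] that
    [Sf] has in these entries. *)
Lemma selfdual_Sf y A B : (A < 4)%nat -> (B < 4)%nat ->
  (forall i j, (i < 4)%nat -> (j < 4)%nat -> y i j = - y j i)%C ->
  let p := fun i j => (/ 2 * (y i j - Ci * starT y i j))%C in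
  p A B = Sf (- Ci * p 0%nat 1%nat) (- Ci * p 0%nat 2%nat) (- Ci * p 0%nat 3%nat) A B.
Proof.
  intros HA HB Hy p. pose proof two_neq_0.
  assert (Y0 : forall i, (i < 4)%nat -> y i i = RtoC 0).
  { intros i Hi. transitivity (/ 2 * (y i i + y i i))%C; [field; auto|].
    rewrite (Hy i i) at 1 by auto. ring. }
  subst p. cases4 A; cases4 B; unfold starT; cbn [Sf];
  rewrite ?(Y0 0%nat), ?(Y0 1%nat), ?(Y0 2%nat), ?(Y0 3%nat),
   ?(Hy 1%nat 0%nat), ?(Hy 2%nat 0%nat), ?(Hy 3%nat 0%nat), ?(Hy 2%nat 1%nat),
    ?(Hy 3%nat 1%nat), ?(Hy 3%nat 2%nat) by lia; field; auto.
Qed.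

(** * The explicit geometry of the conformally rescaled Kerr metric *)

Section KerrMetric.
Variables M a : R.
Notation U := (KerrDom M a).

Definition rr (x : R4) : C := RtoC (x 1%nat).
Definition qq (x : R4) : C := RtoC (x 2%nat).
(* [zz] and [zb] are 1 / lambda_+ and 1 / lambda_-; [cc] and [dd] are C(r) and D(q). *)
Definition zz (x : R4) : C := (rr x + Ci * RtoC a * qq x)%C.
Definition zb (x : R4) : C := (rr x - Ci * RtoC a * qq x)%C.
Definition cc (x : R4) : C := (rr x ^ 2 - RtoC 2 * RtoC M * rr x + RtoC a ^ 2)%C.
Definition dd (x : R4) : C := (RtoC 1 - qq x ^ 2)%C.
Definition cc' (x : R4) : C := (RtoC 2 * (rr x - RtoC M))%C.

Lemma zz_zb x : (zz x * zb x)%C = RtoC (rho2 a (x 1%nat) (x 2%nat)).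
Proof. unfold zz, zb, rr, qq, rho2. rewrite !RtoC_plus, !RtoC_mult, !RtoC_pow. ring. Qed.
Lemma cc_RtoC x : cc x = RtoC (Cr M a (x 1%nat)).
Proof. unfold cc, rr, Cr. now rewrite RtoC_plus, RtoC_minus, !RtoC_mult, !RtoC_pow. Qed.
Lemma dd_RtoC x : dd x = RtoC (Dq (x 2%nat)).
Proof. unfold dd, qq, Dq. now rewrite RtoC_minus, !RtoC_pow. Qed.

Lemma Dq_pos x : U x -> 0 < Dq (x 2%nat).
Proof. intros [_ [H _]]. unfold Dq. nra. Qed.

Lemma zz_zb_neq_0 x : U x -> (zz x * zb x)%C <> RtoC 0.
Proof. intros [_ [_ H]]. rewrite zz_zb. apply RtoC_neq_0. lra. Qed.
Lemma zz_neq_0 x : U x -> zz x <> RtoC 0.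
Proof. intros H E. apply (zz_zb_neq_0 x H). rewrite E. ring. Qed.
Lemma zb_neq_0 x : U x -> zb x <> RtoC 0.
Proof. intros H E. apply (zz_zb_neq_0 x H). rewrite E. ring. Qed.
Lemma cc_neq_0 x : U x -> cc x <> RtoC 0.
Proof. intros [H _]. rewrite cc_RtoC. apply RtoC_neq_0. lra. Qed.
Lemma dd_neq_0 x : U x -> dd x <> RtoC 0.
Proof. intros H. rewrite dd_RtoC. apply RtoC_neq_0. pose proof (Dq_pos x H). lra. Qed.

Ltac kerr_neq0 x H :=
  pose proof (zz_neq_0 x H) as Hz; pose proof (zb_neq_0 x H) as Hb;
  pose proof (cc_neq_0 x H) as Hc; pose proof (dd_neq_0 x H) as Hd.

(* The 1-forms [uu] = (rho / sqrt C) e^0 and [vv] = (rho / sqrt D) e^3; the dual vectors are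
   [UU] / rho2 and [VV] / rho2. *)
Definition uu (m : nat) (x : R4) : C :=
  match m with 0%nat => RtoC 1 | 3%nat => (- RtoC a * dd x)%C | _ => RtoC 0 end.
Definition vv (m : nat) (x : R4) : C :=
  match m with 0%nat => (- RtoC a)%C | 3%nat => (rr x ^ 2 + RtoC a ^ 2)%C | _ => RtoC 0 end.
Definition UU (m : nat) (x : R4) : C :=
  match m with 0%nat => (rr x ^ 2 + RtoC a ^ 2)%C | 3%nat => RtoC a | _ => RtoC 0 end.
Definition VV (m : nat) (x : R4) : C :=
  match m with 0%nat => (RtoC a * dd x)%C | 3%nat => RtoC 1 | _ => RtoC 0 end.

(** The rescaled metric without roots, by $\rho^2=$ [zz * zb] and $\lambda_+=1/$[zz]. Mixed entries
    with an index 1 or 2 fall into the last branch and vanish there, because [uu] and [vv] do. *)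
Definition gc (m n : nat) (x : R4) : C :=
  match m, n with
  | 1%nat, 1%nat => zb x / (zz x * cc x)
  | 2%nat, 2%nat => zb x / (zz x * dd x)
  | _, _ => (dd x * vv m x * vv n x - cc x * uu m x * uu n x) / (zz x ^ 3 * zb x)
  end%C.
Definition gci (m n : nat) (x : R4) : C :=
  match m, n with
  | 1%nat, 1%nat => zz x * cc x / zb x
  | 2%nat, 2%nat => zz x * dd x / zb x
  | _, _ => zz x / zb x * (VV m x * VV n x / dd x - UU m x * UU n x / cc x)
  end%C.

Lemma lamp_zz x : lamp a x = (/ zz x)%C.
Proof. unfold lamp, zz, rr, qq. rewrite RtoC_mult. f_equal. ring. Qed.

Ltac sqrt_setup x H :=
  destruct (H) as [HC [HD HR]]; pose proof (Dq_pos x H) as HD';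
  assert (EC : RtoC (sqrt (Cr M a (x 1%nat))) <> RtoC 0)
    by (apply RtoC_neq_0, Rgt_not_eq, sqrt_lt_R0, HC);
  assert (ED : RtoC (sqrt (Dq (x 2%nat))) <> RtoC 0)
    by (apply RtoC_neq_0, Rgt_not_eq, sqrt_lt_R0, HD');
  assert (ER : RtoC (rho a (x 1%nat) (x 2%nat)) <> RtoC 0)
    by (apply RtoC_neq_0, Rgt_not_eq, sqrt_lt_R0, HR);
  assert (QC : cc x = (RtoC (sqrt (Cr M a (x 1%nat))) ^ 2)%C)
    by (rewrite cc_RtoC, <- RtoC_pow; f_equal; simpl; rewrite Rmult_1_r, sqrt_sqrt; lra);
  assert (QD : dd x = (RtoC (sqrt (Dq (x 2%nat))) ^ 2)%C)
    by (rewrite dd_RtoC, <- RtoC_pow; f_equal; simpl; rewrite Rmult_1_r, sqrt_sqrt; lra);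
  assert (QR : (zz x * zb x)%C = (RtoC (rho a (x 1%nat) (x 2%nat)) ^ 2)%C)
    by (rewrite zz_zb, <- RtoC_pow; f_equal; unfold rho; simpl; rewrite Rmult_1_r, sqrt_sqrt; lra).

(** The embedding of the reals is pushed to the leaves, so that [field] over the complex numbers
    sees the three roots as atoms. *)
Definition cofC (A mu : nat) (x : R4) : C :=
  let sC := RtoC (sqrt (Cr M a (x 1%nat))) in let sD := RtoC (sqrt (Dq (x 2%nat))) in
  let p := RtoC (rho a (x 1%nat) (x 2%nat)) in
  match A, mu with
  | 0%nat, 0%nat => sC / p
  | 0%nat, 3%nat => - RtoC a * dd x * sC / p
  | 1%nat, 1%nat => p / sC
  | 2%nat, 2%nat => p / sD
  | 3%nat, 0%nat => - RtoC a * sD / p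
  | 3%nat, 3%nat => (rr x ^ 2 + RtoC a ^ 2) * sD / p
  | _, _ => RtoC 0
  end%C.
Definition frC (A mu : nat) (x : R4) : C :=
  let sC := RtoC (sqrt (Cr M a (x 1%nat))) in let sD := RtoC (sqrt (Dq (x 2%nat))) in
  let p := RtoC (rho a (x 1%nat) (x 2%nat)) in
  match A, mu with
  | 0%nat, 0%nat => (rr x ^ 2 + RtoC a ^ 2) / (p * sC)
  | 0%nat, 3%nat => RtoC a / (p * sC)
  | 1%nat, 1%nat => sC / p
  | 2%nat, 2%nat => sD / p
  | 3%nat, 0%nat => RtoC a * dd x / (p * sD)
  | 3%nat, 3%nat => RtoC 1 / (p * sD)
  | _, _ => RtoC 0
  end%C.

Lemma sqrts_neq_0 x : U x -> sqrt (Cr M a (x 1%nat)) <> 0 /\ sqrt (Dq (x 2%nat)) <> 0 /\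
  rho a (x 1%nat) (x 2%nat) <> 0.
Proof.
  intros H. pose proof (Dq_pos x H). destruct H as [? [? ?]].
  repeat split; apply Rgt_not_eq, sqrt_lt_R0; auto.
Qed.

Lemma cof_cofC x A mu : U x -> RtoC (cof M a A mu x) = cofC A mu x.
Proof.
  intros H. destruct (sqrts_neq_0 x H) as [HC [HD HR]].
  unfold cof, cofC, rr, dd, qq.
  do 4 (try destruct A as [|A]); do 4 (try destruct mu as [|mu]); try reflexivity;
  rewrite ?RtoC_div by assumption;
  repeat rewrite ?RtoC_mult, ?RtoC_opp, ?RtoC_plus, ?RtoC_minus, ?RtoC_pow; reflexivity.
Qed.
Lemma fr_frC x A mu : U x -> RtoC (fr M a A mu x) = frC A mu x.
Proof.
  intros H. destruct (sqrts_neq_0 x H) as [HC [HD HR]].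
  unfold fr, frC, rr, dd, qq.
  do 4 (try destruct A as [|A]); do 4 (try destruct mu as [|mu]); try reflexivity;
  rewrite ?RtoC_div by (repeat apply Rmult_integral_contrapositive_currified; assumption);
  repeat rewrite ?RtoC_mult, ?RtoC_opp, ?RtoC_plus, ?RtoC_minus, ?RtoC_pow; reflexivity.
Qed.

Lemma g_gc x m n : U x -> (m < 4)%nat -> (n < 4)%nat -> g M a m n x = gc m n x.
Proof.
  intros H Hm Hn. sqrt_setup x H.
  pose proof (zz_neq_0 x H) as Hz. pose proof (zb_neq_0 x H) as Hb.
  unfold g, gKerr. rewrite lamp_zz, !RtoC_plus, !RtoC_mult, !(cof_cofC x) by assumption.
  assert (Eb : zb x = (RtoC (rho a (x 1%nat) (x 2%nat)) ^ 2 / zz x)%C)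
    by (rewrite <- QR; field; auto).
  cases4 m; cases4 n; unfold eta, cofC, gc, uu, vv; cbn [Nat.eqb];
  rewrite ?Eb, ?QC, ?QD; fieldC.
Qed.

Lemma ginv_gci x m n : U x -> (m < 4)%nat -> (n < 4)%nat -> ginv M a m n x = gci m n x.
Proof.
  intros H Hm Hn. sqrt_setup x H.
  pose proof (zz_neq_0 x H) as Hz. pose proof (zb_neq_0 x H) as Hb.
  unfold ginv, gKerrinv. rewrite lamp_zz, !RtoC_plus, !RtoC_mult, !(fr_frC x) by assumption.
  assert (Eb : zb x = (RtoC (rho a (x 1%nat) (x 2%nat)) ^ 2 / zz x)%C)
    by (rewrite <- QR; field; auto).
  cases4 m; cases4 n; unfold eta, frC, gci, UU, VV; cbn [Nat.eqb];
  rewrite ?Eb, ?QC, ?QD; fieldC.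
Qed.

Lemma is_pd_rr x mu : is_pd mu rr x (RtoC (if Nat.eqb 1 mu then 1 else 0)).
Proof. apply is_pd_coord. Qed.
Lemma is_pd_qq x mu : is_pd mu qq x (RtoC (if Nat.eqb 2 mu then 1 else 0)).
Proof. apply is_pd_coord. Qed.
Lemma is_pd_zz x mu : is_pd mu zz x
  (match mu with 1%nat => RtoC 1 | 2%nat => Ci * RtoC a | _ => RtoC 0 end)%C.
Proof.
  unfold zz. evar_last.
  apply is_pd_plus; [apply is_pd_rr|apply is_pd_mult; [apply is_pd_const|apply is_pd_qq]].
  destruct mu as [|[|[|mu]]]; cbn [Nat.eqb]; ring.
Qed.
Lemma is_pd_zb x mu : is_pd mu zb x
  (match mu with 1%nat => RtoC 1 | 2%nat => - (Ci * RtoC a) | _ => RtoC 0 end)%C.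
Proof.
  unfold zb. evar_last.
  apply is_pd_minus; [apply is_pd_rr|apply is_pd_mult; [apply is_pd_const|apply is_pd_qq]].
  destruct mu as [|[|[|mu]]]; cbn [Nat.eqb]; ring.
Qed.
Lemma is_pd_cc x mu : is_pd mu cc x (match mu with 1%nat => cc' x | _ => RtoC 0 end).
Proof.
  unfold cc, cc'. evar_last.
  apply is_pd_plus; [apply is_pd_minus; [apply is_pd_pow, is_pd_rr
    |apply is_pd_mult; [apply is_pd_const|apply is_pd_rr]]|apply is_pd_const].
  destruct mu as [|[|[|mu]]]; cbn [Nat.eqb pred INR]; rewrite ?RtoC_plus; ring.
Qed.
Lemma is_pd_cc' x mu : is_pd mu cc' x (match mu with 1%nat => RtoC 2 | _ => RtoC 0 end).
Proof.
  unfold cc'. evar_last.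
  apply is_pd_mult; [apply is_pd_const|apply is_pd_minus; [apply is_pd_rr|apply is_pd_const]].
  destruct mu as [|[|[|mu]]]; cbn [Nat.eqb]; ring.
Qed.
Lemma is_pd_dd x mu : is_pd mu dd x (match mu with 2%nat => - RtoC 2 * qq x | _ => RtoC 0 end)%C.
Proof.
  unfold dd. evar_last.
  apply is_pd_minus; [apply is_pd_const|apply is_pd_pow, is_pd_qq].
  destruct mu as [|[|[|mu]]]; cbn [Nat.eqb pred INR]; rewrite ?RtoC_plus; ring.
Qed.

Lemma Cpow_neq_0 (z : C) n : z <> RtoC 0 -> (z ^ n)%C <> RtoC 0.
Proof. intros H. apply Cpow_nz. exact H. Qed.

Ltac pd_solve :=
  repeat first
   [ simple apply is_pd_const | simple apply is_pd_rr | simple apply is_pd_qq | simple apply is_pd_zz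
   | simple apply is_pd_zb | simple apply is_pd_cc | simple apply is_pd_cc' | simple apply is_pd_dd
   | simple apply is_pd_plus | simple apply is_pd_minus | simple apply is_pd_opp
   | simple apply is_pd_div | simple apply is_pd_mult | simple apply is_pd_pow ].
Ltac neq0 := repeat first [assumption | simple apply Cpow_neq_0 | simple apply Cmult_neq_0 | split].

Definition duu (m n : nat) (x : R4) : C :=
  match m, n with 2%nat, 3%nat => RtoC 2 * RtoC a * qq x | _, _ => RtoC 0 end%C.
Definition dvv (m n : nat) (x : R4) : C :=
  match m, n with 1%nat, 3%nat => RtoC 2 * rr x | _, _ => RtoC 0 end%C.
(* Logarithmic derivatives of zb / zz and of 1 / (zz^3 zb). *)
Definition lam1 (m : nat) (x : R4) : C :=
  match m with
  | 1%nat => RtoC 1 / zb x - RtoC 1 / zz x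
  | 2%nat => - (Ci * RtoC a) * (RtoC 1 / zb x + RtoC 1 / zz x)
  | _ => RtoC 0 end%C.
Definition lam2 (m : nat) (x : R4) : C :=
  match m with
  | 1%nat => - (RtoC 3 / zz x + RtoC 1 / zb x)
  | 2%nat => - (Ci * RtoC a) * (RtoC 3 / zz x - RtoC 1 / zb x)
  | _ => RtoC 0 end%C.
Definition dcc (m : nat) (x : R4) : C := match m with 1%nat => cc' x | _ => RtoC 0 end.
Definition ddd (m : nat) (x : R4) : C :=
  match m with 2%nat => - RtoC 2 * qq x | _ => RtoC 0 end%C.
Definition dgc (k m n : nat) (x : R4) : C :=
  match m, n with
  | 1%nat, 1%nat => zb x / (zz x * cc x) * (lam1 k x - dcc k x / cc x)
  | 2%nat, 2%nat => zb x / (zz x * dd x) * (lam1 k x - ddd k x / dd x)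
  | _, _ => (lam2 k x * (dd x * vv m x * vv n x - cc x * uu m x * uu n x)
      + ddd k x * vv m x * vv n x + dd x * (dvv k m x * vv n x + vv m x * dvv k n x)
      - dcc k x * uu m x * uu n x - cc x * (duu k m x * uu n x + uu m x * duu k n x))
      / (zz x ^ 3 * zb x)
  end%C.

Lemma is_pd_gc x k m n : U x -> (k < 4)%nat -> (m < 4)%nat -> (n < 4)%nat ->
  is_pd k (gc m n) x (dgc k m n x).
Proof.
  intros H Hk Hm Hn.
  pose proof (zz_neq_0 x H) as Hz. pose proof (zb_neq_0 x H) as Hb.
  pose proof (cc_neq_0 x H) as Hc. pose proof (dd_neq_0 x H) as Hd.
  cases4 m; cases4 n; unfold gc, uu, vv; (evar_last; [pd_solve; neq0|]);
  cases4 k; unfold dgc, lam1, lam2, duu, dvv, dcc, ddd, uu, vv; cbn [Nat.eqb pred INR];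
  rewrite ?RtoC_plus; fieldC.
Qed.

Lemma pd_g x k m n : U x -> (k < 4)%nat -> (m < 4)%nat -> (n < 4)%nat ->
  pd k (g M a m n) x = dgc k m n x.
Proof.
  intros H Hk Hm Hn.
  rewrite (pd_ext U k (g M a m n) (gc m n) x (KerrDom_open4 M a) H)
    by (intros; apply g_gc; auto).
  now apply is_pd_unique, is_pd_gc.
Qed.

(* With h the (t, phi) block of g: [GT] k is h^-1 d_k h / 2 and [GB] k is - g^{kk} d_k h / 2. *)
Definition GT (k i j : nat) (x : R4) : C :=
  let R2 := (zz x * zb x)%C in
  match k with
  | 1%nat => / RtoC 2 * (lam2 1 x * dl i j + cc' x * UU i x * uu j x / (cc x * R2)
      - RtoC 2 * RtoC a * rr x * dd x * UU i x * vv j x / (cc x * R2 ^ 2)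
      + VV i x * dvv 1 j x / R2 + RtoC 2 * rr x * VV i x * vv j x / R2 ^ 2)
  | _ => / RtoC 2 * (lam2 2 x * dl i j + ddd 2 x * VV i x * vv j x / (dd x * R2)
      - RtoC 2 * RtoC a * qq x * cc x * VV i x * uu j x / (dd x * R2 ^ 2)
      + UU i x * duu 2 j x / R2 + RtoC 2 * RtoC a ^ 2 * qq x * UU i x * uu j x / R2 ^ 2)
  end%C.
Definition GB (k i j : nat) (x : R4) : C :=
  (- (match k with 1%nat => cc x | _ => dd x end) / (RtoC 2 * (zz x * zb x) ^ 2) *
   (lam2 k x * (dd x * vv i x * vv j x - cc x * uu i x * uu j x)
      + ddd k x * vv i x * vv j x + dd x * (dvv k i x * vv j x + vv i x * dvv k j x)
      - dcc k x * uu i x * uu j x - cc x * (duu k i x * uu j x + uu i x * duu k j x)))%C.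
(** The metric splits into a $(t,\phi)$ block and a diagonal $(r,q)$ block and is independent of $t$
    and $\phi$. Hence only symbols with an even number of indices from $\{t,\phi\}$ survive. *)
Definition Gc (l m n : nat) (x : R4) : C :=
  match l, m, n with
  | 1%nat, 1%nat, 1%nat => / RtoC 2 * (lam1 1 x - cc' x / cc x)
  | 1%nat, 1%nat, 2%nat | 1%nat, 2%nat, 1%nat => / RtoC 2 * lam1 2 x
  | 1%nat, 2%nat, 2%nat => - / RtoC 2 * (cc x / dd x * lam1 1 x)
  | 2%nat, 1%nat, 1%nat => - / RtoC 2 * (dd x / cc x * lam1 2 x)
  | 2%nat, 1%nat, 2%nat | 2%nat, 2%nat, 1%nat => / RtoC 2 * lam1 1 x
  | 2%nat, 2%nat, 2%nat => / RtoC 2 * (lam1 2 x - ddd 2 x / dd x)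
  | (1%nat | 2%nat), (0%nat | 3%nat), (0%nat | 3%nat) => GB l m n x
  | (0%nat | 3%nat), (0%nat | 3%nat), (1%nat | 2%nat) => GT n l m x
  | (0%nat | 3%nat), (1%nat | 2%nat), (0%nat | 3%nat) => GT m l n x
  | _, _, _ => RtoC 0
  end%C.

Lemma Gam_Gc x l m n : U x -> (l < 4)%nat -> (m < 4)%nat -> (n < 4)%nat ->
  Gam M a l m n x = Gc l m n x.
Proof.
  intros H Hl Hm Hn.
  pose proof (zz_neq_0 x H) as Hz. pose proof (zb_neq_0 x H) as Hb.
  pose proof (cc_neq_0 x H) as Hc. pose proof (dd_neq_0 x H) as Hd.
  unfold Gam, sum4.
  rewrite !ginv_gci, !pd_g by (auto; lia).
  cases4 l; cases4 m; cases4 n; unfold gci, dgc, Gc, GB, GT, dl, lam1, lam2, duu, dvv, dcc, ddd;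
  cbn [uu vv UU VV Nat.eqb];
  clear H Hl Hm Hn; unfold zz, zb, dd in *;
  (* The identities hold with $C$ and $C'$ as independent symbols; hiding the quadratic keeps the
     polynomials small. *)
  generalize dependent (cc x); intros c Hc;
  fieldC.
Qed.

(** * The parallel form $\omega$ *)

(** The roots cancel in $e^0\wedge e^1=$ [uu] $\wedge\,dr$ and in $e^2\wedge e^3=dq\,\wedge$
    [vv]. *)
Definition omc (m n : nat) (x : R4) : C :=
  ((Ci * (uu m x * dl n 1 - uu n x * dl m 1) - (dl m 2 * vv n x - dl n 2 * vv m x))
   / zz x ^ 2)%C.
Definition domc (k m n : nat) (x : R4) : C :=
  ((Ci * (duu k m x * dl n 1 - duu k n x * dl m 1)
     - (dl m 2 * dvv k n x - dl n 2 * dvv k m x)) / zz x ^ 2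
   - RtoC 2 * (match k with 1%nat => RtoC 1 | 2%nat => Ci * RtoC a | _ => RtoC 0 end)
     / zz x * omc m n x)%C.

Lemma omega_omc x m n : U x -> (m < 4)%nat -> (n < 4)%nat -> omega M a m n x = omc m n x.
Proof.
  intros H Hm Hn. kerr_neq0 x H. sqrt_setup x H.
  unfold omega, Omega, Sigma, wedge. rewrite lamp_zz, !RtoC_minus, !RtoC_mult, !(cof_cofC x) by assumption.
  assert (Eb : zb x = (RtoC (rho a (x 1%nat) (x 2%nat)) ^ 2 / zz x)%C)
    by (rewrite <- QR; field; auto).
  cases4 m; cases4 n; unfold cofC, omc, dl; cbn [uu vv Nat.eqb];
  rewrite ?Eb, ?QC, ?QD; fieldC.
Qed.

Lemma is_pd_omc x k m n : U x -> (k < 4)%nat -> (m < 4)%nat -> (n < 4)%nat ->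
  is_pd k (omc m n) x (domc k m n x).
Proof.
  intros H Hk Hm Hn. kerr_neq0 x H.
  cases4 m; cases4 n; unfold omc; cbn [uu vv]; (evar_last; [pd_solve; neq0|]);
  cases4 k; unfold domc, omc, duu, dvv, dl; cbn [Nat.eqb pred INR uu vv];
  rewrite ?RtoC_plus; fieldC.
Qed.

(** The computation again treats $C$ and $C'$ as symbols: the Kähler property rests on the shape of
    the coframe and not on the particular quadratic. *)
Lemma nabla_omega x k m n : U x -> (k < 4)%nat -> (m < 4)%nat -> (n < 4)%nat ->
  nabla2 M a (omega M a) k m n x = RtoC 0.
Proof.
  intros H Hk Hm Hn. kerr_neq0 x H.
  unfold nabla2, sum4.
  rewrite (pd_ext U k _ (omc m n) x (KerrDom_open4 M a) H) by (intros; apply omega_omc; auto).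
  rewrite (is_pd_unique _ _ _ _ (is_pd_omc x k m n H Hk Hm Hn)).
  rewrite !omega_omc, !Gam_Gc by (auto; lia).
  cases4 k; cases4 m; cases4 n;
  unfold domc, omc, Gc, GB, GT, dl, lam1, lam2, duu, dvv, dcc, ddd;
  cbn [uu vv UU VV Nat.eqb];
  clear H Hk Hm Hn; unfold zz, zb, dd in *;
  generalize dependent (cc x); intros c Hc; fieldC.
Qed.

(** * Ricci tensor and scalar curvature *)

Lemma ex_pd_Gc x k l m n : U x -> (k < 4)%nat -> (l < 4)%nat -> (m < 4)%nat -> (n < 4)%nat ->
  exists v, is_pd k (Gc l m n) x v.
Proof.
  intros H Hk Hl Hm Hn. kerr_neq0 x H. pose proof two_neq_0.
  cases4 l; cases4 m; cases4 n; unfold Gc, GB, GT, dl, lam1, lam2, duu, dvv, dcc, ddd;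
  cbn [uu vv UU VV Nat.eqb];
  eexists; pd_solve; neq0.
Qed.

Lemma C1_Gam l m n : (l < 4)%nat -> (m < 4)%nat -> (n < 4)%nat -> C1 U (Gam M a l m n).
Proof.
  intros Hl Hm Hn. apply (C1_ext U (KerrDom_open4 M a) (Gc l m n)).
  - intros; symmetry; apply Gam_Gc; auto.
  - intros x k Hx Hk. destruct (ex_pd_Gc x k l m n Hx Hk Hl Hm Hn) as [v Hv].
    now rewrite (is_pd_unique _ _ _ _ Hv).
Qed.

(* Logarithmic derivative of sqrt (det g) = zb / zz^3. *)
Definition trG (m : nat) (x : R4) : C :=
  match m with
  | 1%nat => RtoC 1 / zb x - RtoC 3 / zz x
  | 2%nat => - (Ci * RtoC a) * (RtoC 1 / zb x + RtoC 3 / zz x)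
  | _ => RtoC 0
  end%C.

Lemma Gam_trace x m : U x -> (m < 4)%nat -> sum4 (fun l => Gam M a l m l x) = trG m x.
Proof.
  intros H Hm. kerr_neq0 x H. unfold sum4. rewrite !Gam_Gc by (auto; lia).
  cases4 m; unfold trG, Gc, GB, GT, dl, lam1, lam2, duu, dvv, dcc, ddd;
  cbn [uu vv UU VV Nat.eqb];
  clear H Hm; unfold zz, zb, dd in *;
  generalize dependent (cc x); intros c Hc; fieldC.
Qed.

Ltac unfold_Gc := unfold Gc, GB, GT, dl, lam1, lam2, duu, dvv, dcc, ddd;
  cbn [uu vv UU VV Nat.eqb].

(** Contracted Christoffel symbols are the gradient of the logarithm of the volume density.
    Substituting [trG] for them collapses two of the four terms of the Ricci tensor before any
    derivative is expanded. *)
Lemma Ric_closed x m n : U x -> (m < 4)%nat -> (n < 4)%nat ->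
  Ric M a m n x = (sum4 (fun l => pd l (Gc l m n) x) - pd n (trG m) x
    + sum4 (fun k => trG k x * Gc k m n x)
    - sum4 (fun l => sum4 (fun k => Gc l n k x * Gc k m l x)))%C.
Proof.
  intros H Hm Hn. unfold Ric.
  assert (E1 : forall l, (l < 4)%nat -> pd l (Gam M a l m n) x = pd l (Gc l m n) x).
  { intros. apply (pd_ext U); auto using KerrDom_open4. intros; apply Gam_Gc; auto. }
  assert (E2 : pd n (trG m) x = sum4 (fun l => pd n (Gam M a l m l) x)).
  { rewrite <- (pd_sum4 U (fun l => Gam M a l m l)); auto.
    - apply (pd_ext U); auto using KerrDom_open4. intros; symmetry; apply Gam_trace; auto.
    - intros; apply C1_Gam; auto. }
  assert (E3 : forall k, (k < 4)%nat -> sum4 (fun l => Gam M a l l k x) = trG k x).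
  { intros k Hk. rewrite <- Gam_trace by auto. unfold sum4.
    rewrite !Gam_Gc by (auto; lia). cases4 k; reflexivity. }
  rewrite E2. unfold sum4 in *.
  rewrite !E1 by lia. rewrite <- (E3 0%nat), <- (E3 1%nat), <- (E3 2%nat), <- (E3 3%nat) by lia.
  rewrite !Gam_Gc by (auto; lia). ring.
Qed.

Lemma scal_closed x : U x -> scal M a x = (RtoC 12 * RtoC M / zz x)%C.
Proof.
  intros H. kerr_neq0 x H. pose proof two_neq_0 as H2. unfold scal, sum4.
  rewrite !ginv_gci, !Ric_closed by (auto; lia).
  unfold sum4;
  unfold gci; cbn [UU VV].
  (* The value of each derivative is an existential variable that the differentiation rules fill
     in. *)
  repeat match goal with |- context [pd ?k ?F x] =>
    let E := fresh "E" in
    eassert (E : pd k F x = _);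
    [ apply is_pd_unique; unfold trG; unfold_Gc; pd_solve; neq0
    | rewrite E; clear E ] end.
  unfold trG; unfold_Gc.
  cbn [pred INR Nat.eqb]; rewrite ?RtoC_plus.
  (* Here the quadratic $C(r)$ has to be opened: the value $12M/$[zz] is specific to it. *)
  clear H; unfold zz, zb, cc, cc', dd in *.
  fieldC.
Qed.

(** * The recurrent form $\Omega^+$ and its connection form *)

Definition sC (x : R4) : C := RtoC (sqrt (Cr M a (x 1%nat))).
Definition sD (x : R4) : C := RtoC (sqrt (Dq (x 2%nat))).

(** Each of the four wedge products in $\Omega^2+{\rm i}\Omega^3$ is $\sqrt{CD}$ times a rational
    form; for instance $e^0\wedge e^2=\sqrt{CD}\,D^{-1}$ [uu] $\wedge\,dq$. The common factor is
    pulled out. *)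
Definition OPc (m n : nat) (x : R4) : C :=
  (sC x * sD x / (zz x ^ 2 * RtoC (sqrt 2)) *
   (Ci / dd x * (uu m x * dl n 2 - uu n x * dl m 2)
    - (vv m x * dl n 1 - vv n x * dl m 1) / cc x
    - (uu m x * vv n x - uu n x * vv m x) / (zz x * zb x)
    - Ci * (zz x * zb x) / (cc x * dd x) * (dl m 1 * dl n 2 - dl n 1 * dl m 2)))%C.

Lemma sqrt2_neq_0 : RtoC (sqrt 2) <> RtoC 0.
Proof. apply RtoC_neq_0, Rgt_not_eq, sqrt_lt_R0. lra. Qed.

Lemma OmegaP_OPc x m n : U x -> (m < 4)%nat -> (n < 4)%nat -> OmegaP M a m n x = OPc m n x.
Proof.
  intros H Hm Hn. kerr_neq0 x H. sqrt_setup x H. pose proof sqrt2_neq_0 as H2.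
  unfold OmegaP, Omega, Sigma, wedge.
  rewrite lamp_zz, !RtoC_minus, !RtoC_mult, !(cof_cofC x) by assumption.
  assert (Eb : zb x = (RtoC (rho a (x 1%nat) (x 2%nat)) ^ 2 / zz x)%C)
    by (rewrite <- QR; field; auto).
  cases4 m; cases4 n; unfold cofC, OPc, dl, sC, sD; cbn [uu vv Nat.eqb];
  rewrite ?Eb, ?QC, ?QD; fieldC.
Qed.

(** The $(t,\phi)$ component of [uu] $\wedge$ [vv] is $r^2+a^2-a^2D=\rho^2$, which cancels the
    denominator. This component of $\Omega^+$ is therefore nowhere zero and easy to
    differentiate. *)
Lemma OPc_03 x : U x -> OPc 0%nat 3%nat x = (- (sC x * sD x) / (zz x ^ 2 * RtoC (sqrt 2)))%C.
Proof.
  intros H. kerr_neq0 x H. sqrt_setup x H. pose proof sqrt2_neq_0 as H2.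
  unfold OPc, dl, sC, sD; cbn [uu vv Nat.eqb]. clear QR QC QD.
  unfold zz, zb, dd in *; fieldC.
Qed.

Lemma is_pd_sC x k : U x -> is_pd k sC x (dcc k x / (RtoC 2 * sC x))%C.
Proof.
  intros H. apply (is_pd_sqrt k (fun y => Cr M a (y 1%nat))).
  - apply (is_pd_ext U k cc); auto using KerrDom_open4.
    + intros; apply cc_RtoC.
    + apply is_pd_cc.
  - apply H.
Qed.
Lemma is_pd_sD x k : U x -> is_pd k sD x (ddd k x / (RtoC 2 * sD x))%C.
Proof.
  intros H. apply (is_pd_sqrt k (fun y => Dq (y 2%nat))).
  - apply (is_pd_ext U k dd); auto using KerrDom_open4.
    + intros; apply dd_RtoC.
    + apply is_pd_dd.
  - now apply Dq_pos.
Qed.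

(** The connection 1-form in closed form, certified by the $(t,\phi)$ component of
    $\nabla\Omega^+$. *)
Definition Ac (m : nat) (x : R4) : C :=
  ((Ci / RtoC 2 * cc' x * uu m x - qq x * vv m x) / (zz x * zb x)
   - RtoC 2 * Ci * (cc x * uu m x + RtoC a * dd x * vv m x) / (zz x ^ 2 * zb x))%C.

Lemma nabla_OmegaP_03 x k : U x -> (k < 4)%nat ->
  nabla2 M a (OmegaP M a) k 0%nat 3%nat x = (- Ci * Ac k x * OmegaP M a 0%nat 3%nat x)%C.
Proof.
  intros H Hk. kerr_neq0 x H. sqrt_setup x H. pose proof sqrt2_neq_0 as H2.
  pose proof two_neq_0 as H2'.
  unfold nabla2.
  assert (E : pd k (OmegaP M a 0%nat 3%nat) x =
     (OPc 0%nat 3%nat x * (dcc k x / (RtoC 2 * cc x) + ddd k x / (RtoC 2 * dd x)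
        - RtoC 2 * (match k with 1%nat => RtoC 1 | 2%nat => Ci * RtoC a | _ => RtoC 0 end) / zz x))%C).
  { rewrite (pd_ext U k _ (fun x => - (sC x * sD x) / (zz x ^ 2 * RtoC (sqrt 2)))%C x (KerrDom_open4 M a) H)
      by (intros; rewrite OmegaP_OPc by (auto; lia); apply OPc_03; auto).
    erewrite is_pd_unique.
    2:{ apply is_pd_div; [|pd_solve|neq0].
        apply is_pd_opp, is_pd_mult; [now apply is_pd_sC|now apply is_pd_sD]. }
    rewrite OPc_03 by auto. cbn [pred INR]. rewrite RtoC_plus, QC, QD. unfold sC, sD. fieldC. }
  rewrite E. unfold sum4. rewrite !OmegaP_OPc, !Gam_Gc by (auto; lia).
  clear E QR QC QD H. unfold OPc, Ac.
  generalize (sC x * sD x)%C; intros w.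
  cases4 k; unfold Gc, GB, GT, dl, lam1, lam2, duu, dvv, dcc, ddd;
  cbn [uu vv UU VV Nat.eqb];
  generalize dependent (cc x); intros c Hc;
  unfold zz, zb, dd in *; fieldC.
Qed.

(** One component in which $\Omega^+$ does not vanish determines the form. The remaining components
    of the recurrence are read from the hypothesis and need no computation. *)
Lemma conn_form_closed Acon : is_conn_form M a Acon ->
  forall x, U x -> forall k, (k < 4)%nat -> Acon k x = Ac k x.
Proof.
  intros HA x H k Hk. kerr_neq0 x H. pose proof sqrt2_neq_0 as H2. pose proof two_neq_0 as H2'.
  destruct (sqrts_neq_0 x H) as [EC [ED _]].
  destruct (HA x H k 0%nat 3%nat) as [E _]; try lia.
  rewrite (nabla_OmegaP_03 x k H Hk) in E.
  assert (N : OmegaP M a 0%nat 3%nat x <> RtoC 0).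
  { rewrite OmegaP_OPc, OPc_03 by (auto; lia). unfold sC, sD.
    intros E'. assert (E'' : (RtoC (sqrt (Cr M a (x 1%nat))) * RtoC (sqrt (Dq (x 2%nat))) = 0)%C).
    { transitivity (- (- (RtoC (sqrt (Cr M a (x 1%nat))) * RtoC (sqrt (Dq (x 2%nat)))) / (zz x ^ 2 * RtoC (sqrt 2))) * (zz x ^ 2 * RtoC (sqrt 2)))%C; [field; auto|rewrite E'; ring]. }
    revert E''. apply Cmult_neq_0; now apply RtoC_neq_0. }
  assert (E1 : (Acon k x - Ac k x)%C = RtoC 0).
  { transitivity (- Ci / OmegaP M a 0%nat 3%nat x * (- Ci * Ac k x * OmegaP M a 0%nat 3%nat x + Ci * Acon k x * OmegaP M a 0%nat 3%nat x))%C;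
      [field; auto | rewrite E; ring]. }
  transitivity (Ac k x + (Acon k x - Ac k x))%C; [ring | rewrite E1; ring].
Qed.

Lemma C1_Ac k : (k < 4)%nat -> C1 U (Ac k).
Proof.
  intros Hk x m H Hm. kerr_neq0 x H. pose proof two_neq_0 as H2.
  assert (E : exists v, is_pd m (Ac k) x v).
  { cases4 k; unfold Ac; cbn [uu vv]; eexists; pd_solve; neq0. }
  destruct E as [v Hv]. now rewrite (is_pd_unique _ _ _ _ Hv).
Qed.

(** These six products are the ones that occur in the self-dual components of a 2-form. The roots
    enter them only through [w], which can then be treated as a single nonzero atom. *)
Lemma frC_products x m n (R2 := (zz x * zb x)%C) (w := (sC x * sD x)%C) :
  U x -> (m < 4)%nat -> (n < 4)%nat ->
  ((frC 0 m x * frC 1 n x = UU m x * dl n 1 / R2) /\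
  (frC 2 m x * frC 3 n x = dl m 2 * VV n x / R2) /\
  (frC 0 m x * frC 2 n x = dd x * UU m x * dl n 2 / (w * R2)) /\
  (frC 3 m x * frC 1 n x = cc x * VV m x * dl n 1 / (w * R2)) /\
  (frC 0 m x * frC 3 n x = UU m x * VV n x / (w * R2)) /\
  (frC 1 m x * frC 2 n x = w * dl m 1 * dl n 2 / R2))%C.
Proof.
  intros H Hm Hn. kerr_neq0 x H. sqrt_setup x H. subst R2 w. unfold sC, sD. rewrite QR.
  cases4 m; cases4 n; unfold frC, dl; cbn [UU VV Nat.eqb]; rewrite ?QC, ?QD;
  repeat split; fieldC.
Qed.

(* The self-dual part of dA is (s/4) omega, with s = 12 M / zz. *)
Lemma frame_dAc x (P := frame2 M a (d1 Ac)) : U x ->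
  (P 0%nat 1%nat x - Ci * P 2%nat 3%nat x = Ci * (RtoC 6 * RtoC M / zz x ^ 3))%C /\
  (P 0%nat 2%nat x - Ci * P 3%nat 1%nat x = 0)%C /\
  (P 0%nat 3%nat x - Ci * P 1%nat 2%nat x = 0)%C.
Proof.
  intros H. kerr_neq0 x H. pose proof two_neq_0 as H2. subst P.
  destruct (sqrts_neq_0 x H) as [EC [ED _]].
  assert (Hw : (sC x * sD x)%C <> RtoC 0) by (apply Cmult_neq_0; now apply RtoC_neq_0).
  unfold frame2.
  assert (E : forall A B, sum4 (fun m => sum4 (fun n => RtoC (fr M a A m x * fr M a B n x) * d1 Ac m n x))%C
     = sum4 (fun m => sum4 (fun n => (frC A m x * frC B n x) * d1 Ac m n x))%C).
  { intros. unfold sum4. rewrite !RtoC_mult, !(fr_frC x) by assumption. reflexivity. }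
  rewrite !E; clear E. unfold sum4.
  pose proof (fun m n Hm Hn => proj1 (frC_products x m n H Hm Hn)) as F1.
  pose proof (fun m n Hm Hn => proj1 (proj2 (frC_products x m n H Hm Hn))) as F2.
  pose proof (fun m n Hm Hn => proj1 (proj2 (proj2 (frC_products x m n H Hm Hn)))) as F3.
  pose proof (fun m n Hm Hn => proj1 (proj2 (proj2 (proj2 (frC_products x m n H Hm Hn))))) as F4.
  pose proof (fun m n Hm Hn => proj1 (proj2 (proj2 (proj2 (proj2 (frC_products x m n H Hm Hn)))))) as F5.
  pose proof (fun m n Hm Hn => proj2 (proj2 (proj2 (proj2 (proj2 (frC_products x m n H Hm Hn)))))) as F6.
  cbv zeta in *.
  rewrite !F1, !F2, !F3, !F4, !F5, !F6 by lia. clear F1 F2 F3 F4 F5 F6.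
  unfold dl, d1; cbn [UU VV Nat.eqb].
  generalize dependent (sC x * sD x)%C; intros w Hw.
  repeat match goal with |- context [pd ?k ?F x] =>
    let E := fresh "E" in
    eassert (E : pd k F x = _);
    [ apply is_pd_unique; unfold Ac; cbn [uu vv]; pd_solve; neq0
    | rewrite E; clear E ] end.
  cbn [pred INR Nat.eqb]; rewrite ?RtoC_plus.
  clear H; unfold zz, zb, cc, cc', dd in *.
  repeat split; fieldC.
Qed.

(** * Regularity of the frame, the forms and the metric *)

Lemma C2_cc : C2 U cc.
Proof.
  pose proof (KerrDom_open4 M a) as HU. unfold cc, rr.
  C2_tac.
Qed.
Lemma C2_dd : C2 U dd.
Proof.
  pose proof (KerrDom_open4 M a) as HU. unfold dd, qq.
  C2_tac.
Qed.
Lemma C2_zz : C2 U zz.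
Proof.
  pose proof (KerrDom_open4 M a) as HU. unfold zz, rr, qq.
  C2_tac.
Qed.
Lemma C2_zb : C2 U zb.
Proof.
  pose proof (KerrDom_open4 M a) as HU. unfold zb, rr, qq.
  C2_tac.
Qed.
Lemma C2_rr : C2 U rr. Proof. apply C2_coord, KerrDom_open4. Qed.
Lemma C2_sC : C2 U sC.
Proof.
  pose proof (KerrDom_open4 M a) as HU. apply C2_sqrt; auto.
  - apply C2_ext with cc; auto using C2_cc. intros; apply cc_RtoC.
  - intros y Hy; apply Hy.
Qed.
Lemma C2_sD : C2 U sD.
Proof.
  pose proof (KerrDom_open4 M a) as HU. apply C2_sqrt; auto.
  - apply C2_ext with dd; auto using C2_dd. intros; apply dd_RtoC.
  - apply Dq_pos.
Qed.
Lemma C2_rho : C2 U (fun x => RtoC (rho a (x 1%nat) (x 2%nat))).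
Proof.
  pose proof (KerrDom_open4 M a) as HU. unfold rho. apply C2_sqrt; auto.
  - apply C2_ext with (fun y => zz y * zb y)%C; auto.
    + intros; apply zz_zb.
    + apply C2_mult; auto using C2_zz, C2_zb.
  - intros y Hy; apply Hy.
Qed.

Lemma C2_cof A m : C2 U (fun x => RtoC (cof M a A m x)).
Proof.
  pose proof (KerrDom_open4 M a) as HU.
  apply C2_ext with (cofC A m); auto.
  { intros; symmetry; now apply cof_cofC. }
  unfold cofC. do 4 (try destruct A as [|A]); do 4 (try destruct m as [|m]);
  cbv zeta; fold sD; fold sC;
  pose proof C2_rr; pose proof C2_dd; pose proof C2_rho; pose proof C2_sC; pose proof C2_sD;
  C2_tac;
  intros y Hy; destruct (sqrts_neq_0 y Hy) as [? [? ?]]; apply RtoC_neq_0; auto.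
Qed.
Lemma C2_fr A m : C2 U (fun x => RtoC (fr M a A m x)).
Proof.
  pose proof (KerrDom_open4 M a) as HU.
  apply C2_ext with (frC A m); auto.
  { intros; symmetry; now apply fr_frC. }
  unfold frC. do 4 (try destruct A as [|A]); do 4 (try destruct m as [|m]);
  cbv zeta; fold sD; fold sC;
  pose proof C2_rr; pose proof C2_dd; pose proof C2_rho; pose proof C2_sC; pose proof C2_sD;
  C2_tac;
  intros y Hy; destruct (sqrts_neq_0 y Hy) as [? [? ?]]; try apply Cmult_neq_0;
  apply RtoC_neq_0; auto.
Qed.
Lemma C2_lamp : C2 U (lamp a).
Proof.
  pose proof (KerrDom_open4 M a) as HU. apply C2_ext with (fun y => / zz y)%C; auto.
  - intros; symmetry; apply lamp_zz.
  - apply C2_inv; auto using C2_zz. apply zz_neq_0.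
Qed.

Lemma C2_Omega i m n : C2 U (Omega M a i m n).
Proof.
  pose proof (KerrDom_open4 M a) as HU. unfold Omega.
  apply C2_mult; auto using C2_pow, C2_lamp.
  assert (Hw : forall A B, C2 U (wedge M a A B m n)).
  { intros. unfold wedge. apply C2_ext with (fun x => RtoC (cof M a A m x) * RtoC (cof M a B n x)
       - RtoC (cof M a A n x) * RtoC (cof M a B m x))%C; auto.
    - intros. now rewrite RtoC_minus, !RtoC_mult.
    - apply C2_minus; auto; apply C2_mult; auto using C2_cof. }
  unfold Sigma. destruct i as [|[|[|i]]];
  (apply C2_minus; [assumption|apply C2_mult; auto using C2_const| auto]).
Qed.

Lemma C2_OmegaP m n : C2 U (OmegaP M a m n).
Proof.
  pose proof (KerrDom_open4 M a) as HU. unfold OmegaP.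
  apply C2_div; auto using C2_const; [apply C2_plus; auto using C2_Omega, C2_mult, C2_const|].
  intros; apply sqrt2_neq_0.
Qed.
Lemma C2_OmegaM m n : C2 U (OmegaM M a m n).
Proof.
  pose proof (KerrDom_open4 M a) as HU. unfold OmegaM.
  apply C2_div; auto using C2_const; [apply C2_minus; auto using C2_Omega, C2_mult, C2_const|].
  intros; apply sqrt2_neq_0.
Qed.

Lemma C2_ginv m n : C2 U (ginv M a m n).
Proof.
  pose proof (KerrDom_open4 M a) as HU. unfold ginv, gKerrinv.
  apply C2_div; auto using C2_pow, C2_lamp.
  - apply C2_ext with (fun x => sum4 (fun A => RtoC (eta A) * (RtoC (fr M a A m x) * RtoC (fr M a A n x))))%C; auto.
    + intros. unfold sum4. rewrite !RtoC_plus, !RtoC_mult. ring.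
    + apply C2_sum4; auto. intros. apply C2_mult; auto using C2_const.
      apply C2_mult; auto using C2_fr.
  - intros y Hy. apply Cpow_neq_0. rewrite lamp_zz. intros E.
    apply (Cmult_neq_0 (zz y) (/ zz y)%C); [now apply (zz_neq_0)| |rewrite E; ring].
    intros _. assert (zz y * / zz y = 1)%C by (apply Cinv_r; now apply (zz_neq_0)).
    rewrite E in H. rewrite Cmult_0_r in H. apply RtoC_inj in H. lra.
Qed.
Lemma C2_g m n : C2 U (g M a m n).
Proof.
  pose proof (KerrDom_open4 M a) as HU. unfold g, gKerr.
  apply C2_mult; auto using C2_pow, C2_lamp.
  apply C2_ext with (fun x => sum4 (fun A => RtoC (eta A) * (RtoC (cof M a A m x) * RtoC (cof M a A n x))))%C; auto.
  + intros. unfold sum4. rewrite !RtoC_plus, !RtoC_mult. ring.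
  + apply C2_sum4; auto. intros. apply C2_mult; auto using C2_const.
    apply C2_mult; auto using C2_cof.
Qed.

(** * Symmetry of the connection and derivative of the inverse metric *)

Lemma g_sym m n x : g M a m n x = g M a n m x.
Proof. unfold g, gKerr. do 2 f_equal. ring. Qed.
Lemma ginv_sym m n x : ginv M a m n x = ginv M a n m x.
Proof. unfold ginv, gKerrinv. do 2 f_equal. ring. Qed.

Lemma Gam_sym l m n x : Gam M a l m n x = Gam M a l n m x.
Proof.
  unfold Gam. f_equal. apply sum4_ext. intros k _.
  replace (g M a n m) with (g M a m n) by (extensionality y; apply g_sym). ring.
Qed.

Lemma g_ginv x k j : U x -> (k < 4)%nat -> (j < 4)%nat ->
  sum4 (fun n => g M a k n x * ginv M a n j x)%C = dl k j.
Proof.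
  intros H Hk Hj. pose proof (zz_neq_0 x H) as Hz. pose proof (zb_neq_0 x H) as Hb.
  pose proof (cc_neq_0 x H) as Hc. pose proof (dd_neq_0 x H) as Hd.
  unfold sum4. rewrite !g_gc, !ginv_gci by (auto; lia).
  cases4 k; cases4 j; unfold gc, gci, dl; cbn [uu vv UU VV Nat.eqb];
  clear H Hk Hj; unfold zz, zb, dd in *;
  generalize dependent (cc x); intros c Hc; fieldC.
Qed.

(** Metric compatibility, $\nabla g^{-1}=0$. With [Ch] the Christoffel symbols of the first kind,
    $\partial g$ is [Ch] plus its transpose; this is inserted into $\partial g^{-1}=-g^{-1}(\partial
    g)\,g^{-1}$. *)
Lemma pd_ginv x m l k : U x -> (m < 4)%nat -> (l < 4)%nat -> (k < 4)%nat ->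
  pd m (ginv M a l k) x = (- sum4 (fun p => Gam M a l m p x * ginv M a p k x)
                           - sum4 (fun p => Gam M a k m p x * ginv M a l p x))%C.
Proof.
  intros H Hm Hl Hk. pose proof (KerrDom_open4 M a) as HU.
  rewrite (deriv_inverse_matrix (fun l k => ginv M a l k x) (fun l k => g M a l k x)
    (fun l k => pd m (ginv M a l k) x) (fun l k => pd m (g M a l k) x)); auto.
  - set (Ch := fun k n => (/ 2 * (pd m (g M a k n) x + pd n (g M a k m) x - pd k (g M a m n) x))%C).
    assert (E1 : forall k n, pd m (g M a k n) x = (Ch k n + Ch n k)%C).
    { intros k0 n0. unfold Ch.
      replace (g M a n0 k0) with (g M a k0 n0) by (extensionality y; apply g_sym).
      replace (g M a n0 m) with (g M a m n0) by (extensionality y; apply g_sym).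
      replace (g M a k0 m) with (g M a m k0) by (extensionality y; apply g_sym).
      field. apply two_neq_0. }
    assert (E2 : forall l n, Gam M a l m n x = sum4 (fun k => ginv M a l k x * Ch k n)%C).
    { intros. unfold Gam, Ch, sum4. ring. }
    transitivity (- sum4 (fun k0 => sum4 (fun n => ginv M a l k0 x * (Ch k0 n + Ch n k0) * ginv M a n k x)))%C.
    { f_equal. apply sum4_ext; intros; apply sum4_ext; intros. now rewrite <- E1. }
    unfold sum4. rewrite !E2. unfold sum4.
    rewrite (ginv_sym 0 k), (ginv_sym 1 k), (ginv_sym 2 k), (ginv_sym 3 k). ring.
  - intros. now apply g_ginv.
  - intros l0 n Hl0 Hn.
    rewrite (sum4_ext _ (fun k => pd m (fun y => ginv M a l0 k y * g M a k n y)%C x)).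
    + rewrite <- (pd_sum4 U (fun k y => ginv M a l0 k y * g M a k n y)%C); auto.
      * rewrite (pd_ext U m _ (fun _ => dl n l0) x HU H).
        { apply is_pd_unique, is_pd_const. }
        (* [g_ginv] has the factors in the other order; the symmetry of both matrices exchanges
           them. *)
        intros y Hy. rewrite <- (g_ginv y n l0) by auto. apply sum4_ext. intros.
        rewrite (g_sym i n), (ginv_sym l0 i). ring.
      * intros. apply C1_mult; apply (C2_C1 U); auto using C2_g, C2_ginv.
    + intros. symmetry. apply (pd_mult U); auto; apply (C2_C1 U); auto using C2_g, C2_ginv.
Qed.

(** * Second-order operators on a multiple of a recurrent form *)

Section Term.
Notation Gam := (Gam M a). Notation ginv := (ginv M a).
Variables (f : Fn) (Om : Form2) (kap : Form1).

Definition covD : Form1 := fun k y => (pd k f y + kap k y * f y)%C.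
(** The charged Hessian. The first index is the direction of the outer derivative; the order matters
    because $d\kappa$ makes the tensor non-symmetric. *)
Definition covH : Form2 := fun m k x => (nabla1 M a covD m k x + kap m x * covD k x)%C.
(** [theta] and [tau] are $\delta(f\,\Omega)$ and $d(f\,\Omega)$ with the recurrence already used.
    Neither contains a derivative of $\Omega$, so each can be differentiated once more. *)
Definition theta : Form1 := fun n y =>
  (- sum4 (fun m => sum4 (fun k => ginv m k y * (covD k y * Om m n y))))%C.
Definition tau : Form3 := fun m n p y =>
  (covD m y * Om n p y + covD n y * Om p m y + covD p y * Om m n y)%C.

Hypothesis Hf : C2 U f.
Hypothesis HOm : forall m n, (m < 4)%nat -> (n < 4)%nat -> C1 U (Om m n).
Hypothesis Hkap : forall m, (m < 4)%nat -> C1 U (kap m).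
Hypothesis Om_anti : forall m n x, Om m n x = (- Om n m x)%C.
Hypothesis Om_par : forall x, U x -> forall k m n, (k < 4)%nat -> (m < 4)%nat -> (n < 4)%nat ->
  nabla2 M a Om k m n x = (kap k x * Om m n x)%C.

Lemma C1_covD k : (k < 4)%nat -> C1 U (covD k).
Proof.
  intros Hk. unfold covD. apply C1_plus; [now apply C2_pd|].
  apply C1_mult; auto. now apply C2_C1.
Qed.

Lemma pd_Om x k m n : U x -> (k < 4)%nat -> (m < 4)%nat -> (n < 4)%nat ->
  pd k (Om m n) x = (kap k x * Om m n x + sum4 (fun l => Gam l k m x * Om l n x)
                     + sum4 (fun l => Gam l k n x * Om m l x))%C.
Proof. intros. rewrite <- Om_par by auto. unfold nabla2. ring. Qed.

Lemma C1_fOm m n : (m < 4)%nat -> (n < 4)%nat -> C1 U (fmul f Om m n).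
Proof. intros. unfold fmul. apply C1_mult; auto. now apply C2_C1. Qed.

Lemma nabla_fOm x k m n : U x -> (k < 4)%nat -> (m < 4)%nat -> (n < 4)%nat ->
  nabla2 M a (fmul f Om) k m n x = (covD k x * Om m n x)%C.
Proof.
  intros H Hk Hm Hn. unfold nabla2, fmul at 1.
  rewrite (pd_mult U f (Om m n) x k) by (auto; now apply C2_C1).
  rewrite pd_Om by auto. unfold covD, fmul, sum4. ring.
Qed.

Lemma delta_fOm x n : U x -> (n < 4)%nat -> delta2 M a (fmul f Om) n x = theta n x.
Proof.
  intros H Hn. unfold delta2, theta. f_equal.
  apply sum4_ext; intros; apply sum4_ext; intros. now rewrite nabla_fOm.
Qed.

Lemma C1_theta n : (n < 4)%nat -> C1 U (theta n).
Proof.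
  intros Hn. unfold theta. apply C1_opp.
  apply (C1_sum4 U (fun m y => sum4 (fun k => ginv m k y * (covD k y * Om m n y))%C)). intros m Hm.
  apply (C1_sum4 U (fun k y => ginv m k y * (covD k y * Om m n y))%C). intros k Hk.
  apply C1_mult; [apply C2_C1, C2_ginv|]. apply C1_mult; auto using C1_covD.
Qed.

Lemma pd_theta x m n : U x -> (m < 4)%nat -> (n < 4)%nat ->
  pd m (theta n) x = (- sum4 (fun l => sum4 (fun k => pd m (ginv l k) x * (covD k x * Om l n x)
     + ginv l k x * (pd m (covD k) x * Om l n x + covD k x * pd m (Om l n) x))))%C.
Proof.
  intros H Hm Hn. unfold theta. apply is_pd_unique, is_pd_opp.
  apply (is_pd_sum4 m (fun l y => sum4 (fun k => ginv l k y * (covD k y * Om l n y))%C)). intros l Hl.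
  apply (is_pd_sum4 m (fun k y => ginv l k y * (covD k y * Om l n y))%C). intros k Hk.
  apply is_pd_mult; [apply (C2_C1 U); auto using C2_ginv|].
  apply is_pd_mult; [apply C1_covD|apply HOm]; auto.
Qed.

(** The product rule for $g^{lk}w_kO_{ln}$: the connection terms on the contracted indices cancel,
    and the one on the free index is the correction in the covariant derivative. Abstract matrices
    keep the identity within reach of [ring]. *)
Lemma leibniz_contraction (I L : nat -> nat -> C) (w dw : nat -> C) (O : nat -> nat -> C) (kp : C) n :
  (sum4 (fun l => sum4 (fun k =>
      (- sum4 (fun p => L l p * I p k) - sum4 (fun p => L k p * I l p)) * (w k * O l n)
      + I l k * (dw k * O l n + w k * (kp * O l n + sum4 (fun p => L p l * O p n)
                     + sum4 (fun p => L p n * O l p)))))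
   - sum4 (fun p => L p n * sum4 (fun l => sum4 (fun k => I l k * (w k * O l p))))
  = sum4 (fun l => sum4 (fun k => I l k * ((dw k - sum4 (fun p => L p k * w p) + kp * w k) * O l n))))%C.
Proof. unfold sum4. ring. Qed.

Lemma nabla_theta x m n : U x -> (m < 4)%nat -> (n < 4)%nat ->
  nabla1 M a theta m n x = (- sum4 (fun l => sum4 (fun k => ginv l k x * (covH m k x * Om l n x))))%C.
Proof.
  intros H Hm Hn. unfold nabla1. rewrite pd_theta by auto.
  unfold covH, nabla1.
  rewrite <- (leibniz_contraction (fun l k => ginv l k x) (fun l k => Gam l m k x)
    (fun k => covD k x) (fun k => pd m (covD k) x) (fun l k => Om l k x) (kap m x) n).
  assert (E : sum4 (fun l => sum4 (fun k => pd m (ginv l k) x * (covD k x * Om l n x)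
     + ginv l k x * (pd m (covD k) x * Om l n x + covD k x * pd m (Om l n) x)))%C =
   (sum4 (fun l => sum4 (fun k =>
      (- sum4 (fun p => Gam l m p x * ginv p k x) - sum4 (fun p => Gam k m p x * ginv l p x)) * (covD k x * Om l n x)
      + ginv l k x * (pd m (covD k) x * Om l n x + covD k x * (kap m x * Om l n x + sum4 (fun p => Gam p m l x * Om p n x)
                     + sum4 (fun p => Gam p m n x * Om l p x))))))%C).
  { apply sum4_ext; intros; apply sum4_ext; intros. now rewrite pd_ginv, pd_Om by auto. }
  rewrite E. unfold theta.
  match goal with |- (- ?X - ?Y = - (?X' - ?Y'))%C =>
    assert (EY : Y = (- Y')%C) by (unfold sum4; ring) end.
  rewrite EY. ring.
Qed.

Lemma d1_nabla1 (th : Form1) m n x : d1 th m n x = (nabla1 M a th m n x - nabla1 M a th n m x)%C.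
Proof.
  unfold d1, nabla1.
  rewrite (sum4_ext (fun l => Gam l n m x * th l x)%C (fun l => Gam l m n x * th l x)%C).
  - ring.
  - intros. now rewrite Gam_sym.
Qed.

Lemma d1_theta x m n : U x -> (m < 4)%nat -> (n < 4)%nat ->
  d1 theta m n x = (- (sum4 (fun l => sum4 (fun k => ginv l k x * (covH m k x * Om l n x)))
                       - sum4 (fun l => sum4 (fun k => ginv l k x * (covH n k x * Om l m x)))))%C.
Proof. intros. rewrite d1_nabla1, !nabla_theta by auto. ring. Qed.

(** The cyclic sum of covariant derivatives equals that of partial derivatives: the connection terms
    cancel in pairs by the symmetry of [Gam] and the antisymmetry of [Om]. *)
Lemma d2_fOm x m n p : U x -> (m < 4)%nat -> (n < 4)%nat -> (p < 4)%nat ->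
  d2 (fmul f Om) m n p x = tau m n p x.
Proof.
  intros H Hm Hn Hp. unfold d2, tau.
  rewrite <- !nabla_fOm by auto. unfold nabla2.
  assert (E : forall i j k, (sum4 (fun l => Gam l i j x * fmul f Om l k x)
       + sum4 (fun l => Gam l j i x * fmul f Om k l x) = 0)%C).
  { intros. rewrite (sum4_ext (fun l => Gam l j i x * fmul f Om k l x)%C
      (fun l => - (Gam l i j x * fmul f Om l k x))%C).
    - unfold sum4; ring.
    - intros. rewrite Gam_sym. unfold fmul. rewrite (Om_anti k i0). ring. }
  pose proof (E m n p) as E1. pose proof (E n p m) as E2. pose proof (E p m n) as E3.
  match goal with |- ?L = ?R => transitivity (R + ((sum4 (fun l => Gam l m n x * fmul f Om l p x)
       + sum4 (fun l => Gam l n m x * fmul f Om p l x)) + (sum4 (fun l => Gam l n p x * fmul f Om l m x)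
       + sum4 (fun l => Gam l p n x * fmul f Om m l x)) + (sum4 (fun l => Gam l p m x * fmul f Om l n x)
       + sum4 (fun l => Gam l m p x * fmul f Om n l x))))%C end.
  - ring.
  - rewrite E1, E2, E3. ring.
Qed.

Lemma C1_tau m n p : (m < 4)%nat -> (n < 4)%nat -> (p < 4)%nat -> C1 U (tau m n p).
Proof.
  intros. unfold tau. apply C1_plus; [apply C1_plus|]; (apply C1_mult; [apply C1_covD|apply HOm]; auto).
Qed.

Lemma nabla_tau x k m n p : U x -> (k < 4)%nat -> (m < 4)%nat -> (n < 4)%nat -> (p < 4)%nat ->
  nabla3 M a tau k m n p x = (covH k m x * Om n p x + covH k n x * Om p m x + covH k p x * Om m n x)%C.
Proof.
  intros H Hk Hm Hn Hp. unfold nabla3.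
  assert (E : forall i j l, (i < 4)%nat -> (j < 4)%nat -> (l < 4)%nat ->
     is_pd k (fun y => covD i y * Om j l y)%C x (pd k (covD i) x * Om j l x + covD i x * pd k (Om j l) x)%C).
  { intros. apply is_pd_mult; [apply C1_covD|apply HOm]; auto. }
  assert (E1 : pd k (tau m n p) x = ((pd k (covD m) x * Om n p x + covD m x * pd k (Om n p) x)
    + (pd k (covD n) x * Om p m x + covD n x * pd k (Om p m) x)
    + (pd k (covD p) x * Om m n x + covD p x * pd k (Om m n) x))%C).
  { unfold tau. apply is_pd_unique. apply is_pd_plus; [apply is_pd_plus|]; apply E; auto. }
  rewrite E1, !pd_Om by auto. unfold covH, nabla1, tau.
  unfold sum4. ring.
Qed.

Lemma delta3_tau x n p : U x -> (n < 4)%nat -> (p < 4)%nat ->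
  delta3 M a tau n p x = (- sum4 (fun m => sum4 (fun k => ginv m k x *
     (covH k m x * Om n p x + covH k n x * Om p m x + covH k p x * Om m n x))))%C.
Proof.
  intros. unfold delta3. f_equal. apply sum4_ext; intros; apply sum4_ext; intros.
  now rewrite nabla_tau.
Qed.

(** The commutator of two charged derivatives is the curvature $d\kappa$: the second derivatives of
    [f] cancel by symmetry, the Christoffel terms by vanishing torsion, and the terms quadratic in
    [kap] because scalars commute. *)
Lemma covH_anti x m k : U x -> (m < 4)%nat -> (k < 4)%nat ->
  (covH m k x - covH k m x)%C = (d1 kap m k x * f x)%C.
Proof.
  intros H Hm Hk. unfold covH.
  assert (E : forall i j, (i < 4)%nat -> (j < 4)%nat -> pd i (covD j) x =
     (pd i (pd j f) x + (pd i (kap j) x * f x + kap j x * pd i f x))%C).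
  { intros. unfold covD. apply is_pd_unique, is_pd_plus.
    - now apply (C2_pd U).
    - apply is_pd_mult; [apply Hkap|apply (C2_C1 U)]; auto. }
  transitivity (d1 covD m k x + kap m x * covD k x - kap k x * covD m x)%C.
  { rewrite (d1_nabla1 covD). ring. }
  unfold d1. rewrite !E by auto. rewrite (C2_sym U f Hf x m k) by auto. unfold covD. ring.
Qed.
End Term.

(** * Passage between coordinate and frame components *)

Lemma fr_cof x A B : U x -> (A < 4)%nat -> (B < 4)%nat ->
  sum4 (fun m => RtoC (fr M a A m x) * RtoC (cof M a B m x))%C = dl A B.
Proof.
  intros H HA HB. sqrt_setup x H. clear QC.
  unfold sum4. rewrite !(fr_frC x), !(cof_cofC x) by assumption.
  (* This eliminates $r$ in favour of $\rho$ and $D$, after which the roots behave as independent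
     atoms. *)
  assert (QR' : (rr x ^ 2 + RtoC a ^ 2)%C = (RtoC (rho a (x 1%nat) (x 2%nat)) ^ 2 + RtoC a ^ 2 * dd x)%C).
  { rewrite <- QR. unfold zz, zb, dd. ring. }
  cases4 A; cases4 B; unfold frC, cofC, dl; cbn [Nat.eqb]; rewrite ?QR', ?QD; fieldC.
Qed.
Lemma cof_fr x m n : U x -> (m < 4)%nat -> (n < 4)%nat ->
  sum4 (fun A => RtoC (cof M a A m x) * RtoC (fr M a A n x))%C = dl m n.
Proof.
  intros H HA HB. sqrt_setup x H. clear QC.
  unfold sum4. rewrite !(fr_frC x), !(cof_cofC x) by assumption.
  assert (QR' : (rr x ^ 2 + RtoC a ^ 2)%C = (RtoC (rho a (x 1%nat) (x 2%nat)) ^ 2 + RtoC a ^ 2 * dd x)%C).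
  { rewrite <- QR. unfold zz, zb, dd. ring. }
  cases4 m; cases4 n; unfold frC, cofC, dl; cbn [Nat.eqb]; rewrite ?QR', ?QD; fieldC.
Qed.

Definition unframe (y : nat -> nat -> C) (m n : nat) (x : R4) : C :=
  sum4 (fun A => sum4 (fun B => RtoC (cof M a A m x * cof M a B n x) * y A B))%C.

Lemma unframe_ext y y' m n x : (forall A B, (A < 4)%nat -> (B < 4)%nat -> y A B = y' A B) ->
  unframe y m n x = unframe y' m n x.
Proof.
  intros H. unfold unframe. apply sum4_ext; intros; apply sum4_ext; intros. now rewrite H.
Qed.

Lemma change_of_frame (c F : nat -> nat -> C) (X : nat -> nat -> C) m n :
  (sum4 (fun A => sum4 (fun B => c A m * c B n * sum4 (fun k => sum4 (fun l => F A k * F B l * X k l))))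
  = sum4 (fun k => sum4 (fun l => sum4 (fun A => c A m * F A k) * sum4 (fun B => c B n * F B l) * X k l)))%C.
Proof. unfold sum4. ring. Qed.

Lemma unframe_frame2 X m n x : U x -> (m < 4)%nat -> (n < 4)%nat ->
  unframe (fun A B => frame2 M a X A B x) m n x = X m n x.
Proof.
  intros H Hm Hn. unfold unframe, frame2.
  transitivity (sum4 (fun A => sum4 (fun B => RtoC (cof M a A m x) * RtoC (cof M a B n x) *
     sum4 (fun k => sum4 (fun l => RtoC (fr M a A k x) * RtoC (fr M a B l x) * X k l x))))%C).
  { apply sum4_ext; intros; apply sum4_ext; intros. rewrite RtoC_mult. f_equal.
    apply sum4_ext; intros; apply sum4_ext; intros. now rewrite RtoC_mult. }
  rewrite (change_of_frame (fun A m => RtoC (cof M a A m x)) (fun A m => RtoC (fr M a A m x))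
     (fun k l => X k l x) m n).
  rewrite (sum4_ext _ (fun k => sum4 (fun l => dl m k * dl n l * X k l x))%C).
  - cases4 m; cases4 n; unfold sum4, dl; cbn [Nat.eqb]; ring.
  - intros; apply sum4_ext; intros. now rewrite !cof_fr.
Qed.

Lemma Pselfdual_frame X m n x : U x -> (m < 4)%nat -> (n < 4)%nat ->
  Pselfdual M a X m n x = (/ 2 * unframe (fun A B =>
     frame2 M a X A B x - Ci * starT (fun A B => frame2 M a X A B x) A B) m n x)%C.
Proof.
  intros H Hm Hn. unfold Pselfdual.
  rewrite <- (unframe_frame2 X m n x) at 1 by auto.
  assert (E : star M a X m n x = unframe (fun A B => starT (fun A B => frame2 M a X A B x) A B) m n x).
  { unfold star, unframe. apply sum4_ext; intros; apply sum4_ext; intros.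
    now rewrite <- starF_starT. }
  rewrite E. unfold unframe, sum4. ring.
Qed.

Lemma lamp_neq_0 x : U x -> lamp a x <> RtoC 0.
Proof.
  intros H E. pose proof (zz_neq_0 x H) as Hz. rewrite lamp_zz in E.
  assert (E1 : (zz x * / zz x = 1)%C) by now apply Cinv_r.
  rewrite E, Cmult_0_r in E1. apply RtoC_inj in E1. lra.
Qed.

Lemma frame2_unframe (y : nat -> nat -> C) (X : Form2) A B x : U x -> (A < 4)%nat -> (B < 4)%nat ->
  (forall m n, (m < 4)%nat -> (n < 4)%nat -> X m n x = unframe y m n x) ->
  frame2 M a X A B x = y A B.
Proof.
  intros H HA HB HX. unfold frame2.
  transitivity (sum4 (fun m => sum4 (fun n => RtoC (fr M a A m x) * RtoC (fr M a B n x) *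
     sum4 (fun k => sum4 (fun l => RtoC (cof M a k m x) * RtoC (cof M a l n x) * y k l))))%C).
  { apply sum4_ext; intros; apply sum4_ext; intros. rewrite RtoC_mult. f_equal.
    rewrite HX by auto. unfold unframe.
    apply sum4_ext; intros; apply sum4_ext; intros. now rewrite RtoC_mult. }
  rewrite (change_of_frame (fun m A => RtoC (fr M a A m x)) (fun m k => RtoC (cof M a k m x)) y A B).
  rewrite (sum4_ext _ (fun k => sum4 (fun l => dl A k * dl B l * y k l))%C).
  - cases4 A; cases4 B; unfold sum4, dl; cbn [Nat.eqb]; ring.
  - intros; apply sum4_ext; intros. now rewrite !fr_cof.
Qed.

Lemma Omega_unframe c1 c2 c3 m n x :
  (lamp a x ^ 2 * (c1 * Sigma M a 1 m n x + c2 * Sigma M a 2 m n x + c3 * Sigma M a 3 m n x))%C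
  = unframe (fun A B => lamp a x ^ 2 * Sf c1 c2 c3 A B)%C m n x.
Proof.
  unfold Sigma, wedge, unframe, sum4. cbn [Sf]. rewrite !RtoC_minus, !RtoC_mult. ring.
Qed.

(** A contraction with the inverse metric becomes a signed sum over the frame. The factor [il] will
    be $\lambda_+^{-2}$, since the frame is orthonormal for $g_{Kerr}$ and not for $g$. *)
Lemma contract_frame (F : nat -> nat -> C) (u w e : nat -> C) (il : C) (I : nat -> nat -> C)
    (T : nat -> nat -> nat -> nat -> C) :
  (forall l k, (l < 4)%nat -> (k < 4)%nat -> I l k = sum4 (fun D => e D * F D l * F D k) * il)%C ->
  (sum4 (fun m => sum4 (fun n => u m * w n * sum4 (fun l => sum4 (fun k => I l k * T m n l k))))
   = il * sum4 (fun D => e D * sum4 (fun m => sum4 (fun n => u m * w n *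
                       sum4 (fun l => sum4 (fun k => F D l * F D k * T m n l k))))))%C.
Proof.
  intros HI.
  assert (E : forall Q : nat -> nat -> nat -> C,
    (sum4 (fun m => sum4 (fun n => u m * w n * sum4 (fun D => il * e D * Q D m n)))
     = il * sum4 (fun D => e D * sum4 (fun m => sum4 (fun n => u m * w n * Q D m n))))%C)
    by (intros; unfold sum4; ring).
  rewrite <- (E (fun D m n => sum4 (fun l => sum4 (fun k => F D l * F D k * T m n l k)))%C).
  apply sum4_ext; intros m Hm; apply sum4_ext; intros n Hn. f_equal.
  rewrite (sum4_ext _ (fun l => sum4 (fun k => sum4 (fun D => e D * F D l * F D k) * il * T m n l k))%C)
    by (intros; apply sum4_ext; intros; now rewrite HI).
  unfold sum4; ring.
Qed.

Lemma ginv_frame x l k : ginv M a l k x =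
  (sum4 (fun D => etaC D * RtoC (fr M a D l x) * RtoC (fr M a D k x)) * / lamp a x ^ 2)%C.
Proof.
  unfold ginv, gKerrinv, sum4, etaC, Cdiv. f_equal. now rewrite !RtoC_plus, !RtoC_mult.
Qed.

Lemma frame2_split X A B x : frame2 M a X A B x =
  sum4 (fun m => sum4 (fun n => RtoC (fr M a A m x) * RtoC (fr M a B n x) * X m n x))%C.
Proof. unfold frame2. apply sum4_ext; intros; apply sum4_ext; intros. now rewrite RtoC_mult. Qed.

Lemma frame2_contract (H O : Form2) A B x :
  frame2 M a (fun m n x => sum4 (fun l => sum4 (fun k => ginv M a l k x * (H m k x * O l n x))))%C A B x
  = (/ lamp a x ^ 2 * sum4 (fun D => etaC D * (frame2 M a H A D x * frame2 M a O D B x)))%C.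
Proof.
  rewrite frame2_split.
  rewrite (contract_frame (fun A m => RtoC (fr M a A m x)) (fun m => RtoC (fr M a A m x))
    (fun m => RtoC (fr M a B m x)) etaC (/ lamp a x ^ 2)%C (fun l k => ginv M a l k x)
    (fun m n l k => H m k x * O l n x)%C) by (intros; apply ginv_frame).
  f_equal. apply sum4_ext; intros D HD. f_equal. rewrite !frame2_split. unfold sum4. ring.
Qed.

Lemma frame2_contract3 (H O : Form2) A B x :
  frame2 M a (fun n p x => sum4 (fun m => sum4 (fun k => ginv M a m k x *
     (H k m x * O n p x + H k n x * O p m x + H k p x * O m n x))))%C A B x
  = (/ lamp a x ^ 2 * sum4 (fun D => etaC D * (frame2 M a H D D x * frame2 M a O A B x
       + frame2 M a H D A x * frame2 M a O B D x + frame2 M a H D B x * frame2 M a O D A x)))%C.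
Proof.
  rewrite frame2_split.
  rewrite (contract_frame (fun A m => RtoC (fr M a A m x)) (fun m => RtoC (fr M a A m x))
    (fun m => RtoC (fr M a B m x)) etaC (/ lamp a x ^ 2)%C (fun l k => ginv M a l k x)
    (fun n p m k => H k m x * O n p x + H k n x * O p m x + H k p x * O m n x)%C)
    by (intros; apply ginv_frame).
  f_equal. apply sum4_ext; intros D HD. f_equal. rewrite !frame2_split. unfold sum4. ring.
Qed.

Lemma trace_frame (H : Form2) x :
  sum4 (fun l => sum4 (fun k => ginv M a l k x * H k l x))%C
  = (/ lamp a x ^ 2 * sum4 (fun D => etaC D * frame2 M a H D D x))%C.
Proof.
  rewrite (sum4_ext _ (fun l => sum4 (fun k => sum4 (fun D => etaC D * RtoC (fr M a D l x) * RtoC (fr M a D k x)) * / lamp a x ^ 2 * H k l x))%C)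
    by (intros; apply sum4_ext; intros; now rewrite ginv_frame).
  rewrite (sum4_ext (fun D => etaC D * _)%C (fun D => etaC D * sum4 (fun m => sum4 (fun n => RtoC (fr M a D m x) * RtoC (fr M a D n x) * H m n x)))%C)
    by (intros; now rewrite frame2_split).
  unfold sum4. ring.
Qed.

Lemma frame2_ext X Y A B x : (forall m n, (m < 4)%nat -> (n < 4)%nat -> X m n x = Y m n x) ->
  frame2 M a X A B x = frame2 M a Y A B x.
Proof. intros H. unfold frame2. apply sum4_ext; intros; apply sum4_ext; intros. now rewrite H. Qed.

(** * Additivity of the first-order operators *)

Lemma pd_sum3 k F X1 X2 X3 x : U x -> (k < 4)%nat -> C1 U X1 -> C1 U X2 -> C1 U X3 ->
  (forall y, U y -> F y = X1 y + X2 y + X3 y)%C ->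
  pd k F x = (pd k X1 x + pd k X2 x + pd k X3 x)%C.
Proof.
  intros H Hk H1 H2 H3 HF. rewrite (pd_ext U k _ _ x (KerrDom_open4 M a) H HF).
  apply is_pd_unique, is_pd_plus; [apply is_pd_plus|]; auto.
Qed.

Lemma delta2_sum3 (F X1 X2 X3 : Form2) :
  (forall m n, (m < 4)%nat -> (n < 4)%nat -> C1 U (X1 m n) /\ C1 U (X2 m n) /\ C1 U (X3 m n)) ->
  (forall y m n, U y -> (m < 4)%nat -> (n < 4)%nat -> F m n y = X1 m n y + X2 m n y + X3 m n y)%C ->
  forall x n, U x -> (n < 4)%nat ->
  delta2 M a F n x = (delta2 M a X1 n x + delta2 M a X2 n x + delta2 M a X3 n x)%C.
Proof.
  intros HC HF x n H Hn. unfold delta2.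
  assert (E : forall k m, (k < 4)%nat -> (m < 4)%nat ->
    nabla2 M a F k m n x = (nabla2 M a X1 k m n x + nabla2 M a X2 k m n x + nabla2 M a X3 k m n x)%C).
  { intros k m Hk Hm. unfold nabla2. destruct (HC m n Hm Hn) as [? [? ?]].
    rewrite (pd_sum3 k (F m n) (X1 m n) (X2 m n) (X3 m n)) by auto.
    unfold sum4. rewrite !HF by (auto; lia). ring. }
  unfold sum4. rewrite !E by lia. ring.
Qed.

Lemma delta3_sum3 (F X1 X2 X3 : Form3) :
  (forall m n p, (m < 4)%nat -> (n < 4)%nat -> (p < 4)%nat ->
     C1 U (X1 m n p) /\ C1 U (X2 m n p) /\ C1 U (X3 m n p)) ->
  (forall y m n p, U y -> (m < 4)%nat -> (n < 4)%nat -> (p < 4)%nat ->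
     F m n p y = X1 m n p y + X2 m n p y + X3 m n p y)%C ->
  forall x n p, U x -> (n < 4)%nat -> (p < 4)%nat ->
  delta3 M a F n p x = (delta3 M a X1 n p x + delta3 M a X2 n p x + delta3 M a X3 n p x)%C.
Proof.
  intros HC HF x n p H Hn Hp. unfold delta3.
  assert (E : forall k m, (k < 4)%nat -> (m < 4)%nat ->
    nabla3 M a F k m n p x = (nabla3 M a X1 k m n p x + nabla3 M a X2 k m n p x + nabla3 M a X3 k m n p x)%C).
  { intros k m Hk Hm. unfold nabla3. destruct (HC m n p Hm Hn Hp) as [? [? ?]].
    rewrite (pd_sum3 k (F m n p) (X1 m n p) (X2 m n p) (X3 m n p)) by auto.
    unfold sum4. rewrite !HF by (auto; lia). ring. }
  unfold sum4. rewrite !E by lia. ring.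
Qed.

Lemma d1_sum3 (F X1 X2 X3 : Form1) :
  (forall n, (n < 4)%nat -> C1 U (X1 n) /\ C1 U (X2 n) /\ C1 U (X3 n)) ->
  (forall y n, U y -> (n < 4)%nat -> F n y = X1 n y + X2 n y + X3 n y)%C ->
  forall x m n, U x -> (m < 4)%nat -> (n < 4)%nat ->
  d1 F m n x = (d1 X1 m n x + d1 X2 m n x + d1 X3 m n x)%C.
Proof.
  intros HC HF x m n H Hm Hn. unfold d1.
  destruct (HC m Hm) as [? [? ?]]. destruct (HC n Hn) as [? [? ?]].
  rewrite (pd_sum3 m (F n) (X1 n) (X2 n) (X3 n)) by auto.
  rewrite (pd_sum3 n (F m) (X1 m) (X2 m) (X3 m)) by auto. ring.
Qed.

Lemma d2_sum3 (F X1 X2 X3 : Form2) :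
  (forall m n, (m < 4)%nat -> (n < 4)%nat -> C1 U (X1 m n) /\ C1 U (X2 m n) /\ C1 U (X3 m n)) ->
  (forall y m n, U y -> (m < 4)%nat -> (n < 4)%nat -> F m n y = X1 m n y + X2 m n y + X3 m n y)%C ->
  forall x m n p, U x -> (m < 4)%nat -> (n < 4)%nat -> (p < 4)%nat ->
  d2 F m n p x = (d2 X1 m n p x + d2 X2 m n p x + d2 X3 m n p x)%C.
Proof.
  intros HC HF x m n p H Hm Hn Hp. unfold d2.
  destruct (HC n p Hn Hp) as [? [? ?]]. destruct (HC p m Hp Hm) as [? [? ?]].
  destruct (HC m n Hm Hn) as [? [? ?]].
  rewrite (pd_sum3 m (F n p) (X1 n p) (X2 n p) (X3 n p)) by auto.
  rewrite (pd_sum3 n (F p m) (X1 p m) (X2 p m) (X3 p m)) by auto.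
  rewrite (pd_sum3 p (F m n) (X1 m n) (X2 m n) (X3 m n)) by auto. ring.
Qed.

(* The instances are omega, Omega^+ and Omega^-, with kap = 0, - i a and i a. *)
Record charged_form (Om : Form2) (kap : Form1) (c1 c2 c3 : C) : Prop := {
  cf_C1 : forall m n, (m < 4)%nat -> (n < 4)%nat -> C1 U (Om m n);
  cf_kap : forall m, (m < 4)%nat -> C1 U (kap m);
  cf_anti : forall m n x, Om m n x = (- Om n m x)%C;
  cf_par : forall x, U x -> forall k m n, (k < 4)%nat -> (m < 4)%nat -> (n < 4)%nat ->
     nabla2 M a Om k m n x = (kap k x * Om m n x)%C;
  cf_unframe : forall m n x, Om m n x = unframe (fun A B => lamp a x ^ 2 * Sf c1 c2 c3 A B)%C m n x
}.

Lemma cf_frame Om kap c1 c2 c3 : charged_form Om kap c1 c2 c3 ->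
  forall x A B, U x -> (A < 4)%nat -> (B < 4)%nat ->
  frame2 M a Om A B x = (lamp a x ^ 2 * Sf c1 c2 c3 A B)%C.
Proof.
  intros HO x A B H HA HB.
  apply (frame2_unframe (fun A B => lamp a x ^ 2 * Sf c1 c2 c3 A B)%C); auto.
  intros; now apply (cf_unframe _ _ _ _ _ HO).
Qed.

(** The factor $\lambda_+^2$ in the frame components of [Om] cancels the $\lambda_+^{-2}$ of the
    inverse metric, which leaves constant coefficients. *)
Lemma frame_d1_theta f Om kap c1 c2 c3 x A B : charged_form Om kap c1 c2 c3 -> C2 U f ->
  U x -> (A < 4)%nat -> (B < 4)%nat ->
  frame2 M a (d1 (theta f Om kap)) A B x =
  curlF (fun A B => frame2 M a (covH f kap) A B x) (Sf c1 c2 c3) A B.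
Proof.
  intros HO Hf H HA HB. pose proof (lamp_neq_0 x H) as Hl.
  pose proof (fun A B => frame2_contract (covH f kap) Om A B x) as E.
  transitivity (- (frame2 M a (fun m n x => sum4 (fun l => sum4 (fun k => ginv M a l k x * (covH f kap m k x * Om l n x))))%C A B x
    - frame2 M a (fun m n x => sum4 (fun l => sum4 (fun k => ginv M a l k x * (covH f kap m k x * Om l n x))))%C B A x))%C.
  - rewrite (frame2_ext (d1 (theta f Om kap)) (fun m n x => - (sum4 (fun l => sum4 (fun k => ginv M a l k x * (covH f kap m k x * Om l n x)))
       - sum4 (fun l => sum4 (fun k => ginv M a l k x * (covH f kap n k x * Om l m x)))))%C).
    + rewrite !frame2_split.
      set (Q := fun m n => sum4 (fun l => sum4 (fun k => ginv M a l k x * (covH f kap m k x * Om l n x)))%C).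
      change (sum4 (fun m => sum4 (fun n => RtoC (fr M a A m x) * RtoC (fr M a B n x) * (- (Q m n - Q n m))))%C
        = (- (sum4 (fun m => sum4 (fun n => RtoC (fr M a A m x) * RtoC (fr M a B n x) * Q m n)) -
        sum4 (fun m => sum4 (fun n => RtoC (fr M a B m x) * RtoC (fr M a A n x) * Q m n))))%C).
      unfold sum4. ring.
    + intros. apply d1_theta; auto; apply HO.
  - rewrite !E. unfold curlF, sum4. rewrite !(cf_frame _ _ _ _ _ HO) by (auto; lia).
    field. auto.
Qed.

Lemma frame_delta3_tau f Om kap c1 c2 c3 x A B : charged_form Om kap c1 c2 c3 -> C2 U f ->
  U x -> (A < 4)%nat -> (B < 4)%nat ->
  frame2 M a (delta3 M a (tau f Om kap)) A B x =
  divF (fun A B => frame2 M a (covH f kap) A B x) (Sf c1 c2 c3) A B.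
Proof.
  intros HO Hf H HA HB. pose proof (lamp_neq_0 x H) as Hl.
  pose proof (fun A B => frame2_contract3 (covH f kap) Om A B x) as E.
  transitivity (- frame2 M a (fun n p x => sum4 (fun m => sum4 (fun k => ginv M a m k x *
     (covH f kap k m x * Om n p x + covH f kap k n x * Om p m x + covH f kap k p x * Om m n x))))%C A B x)%C.
  - rewrite (frame2_ext (delta3 M a (tau f Om kap)) (fun n p x => - sum4 (fun m => sum4 (fun k => ginv M a m k x *
     (covH f kap k m x * Om n p x + covH f kap k n x * Om p m x + covH f kap k p x * Om m n x))))%C).
    + rewrite !frame2_split.
      set (Q := fun n p => sum4 (fun m => sum4 (fun k => ginv M a m k x *
     (covH f kap k m x * Om n p x + covH f kap k n x * Om p m x + covH f kap k p x * Om m n x)))%C).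
      change (sum4 (fun m => sum4 (fun n => RtoC (fr M a A m x) * RtoC (fr M a B n x) * (- Q m n)))%C
        = (- sum4 (fun m => sum4 (fun n => RtoC (fr M a A m x) * RtoC (fr M a B n x) * Q m n)))%C).
      unfold sum4. ring.
    + intros. apply delta3_tau; auto; apply HO.
  - rewrite !E. unfold divF, sum4. rewrite !(cf_frame _ _ _ _ _ HO) by (auto; lia).
    field. auto.
Qed.

(** * Second-order operators on one recurrent term and on sums of three *)

Section OneTerm.
Variables (f : Fn) (Om : Form2) (kap : Form1) (c1 c2 c3 : C).
Hypothesis HO : charged_form Om kap c1 c2 c3.
Hypothesis Hf : C2 U f.
Lemma cf_C1_fmul m n : (m < 4)%nat -> (n < 4)%nat -> C1 U (fmul f Om m n).
Proof. destruct HO; intros; apply (C1_fOm); auto. Qed.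
Lemma cf_C1_theta n : (n < 4)%nat -> C1 U (theta f Om kap n).
Proof. destruct HO; intros; apply C1_theta; auto. Qed.
Lemma cf_C1_tau m n p : (m < 4)%nat -> (n < 4)%nat -> (p < 4)%nat -> C1 U (tau f Om kap m n p).
Proof. destruct HO; intros; apply (C1_tau); auto. Qed.
Lemma cf_delta2 x n : U x -> (n < 4)%nat -> delta2 M a (fmul f Om) n x = theta f Om kap n x.
Proof. destruct HO; intros; apply delta_fOm; auto. Qed.
Lemma cf_d2 x m n p : U x -> (m < 4)%nat -> (n < 4)%nat -> (p < 4)%nat ->
  d2 (fmul f Om) m n p x = tau f Om kap m n p x.
Proof. destruct HO; intros; apply (d2_fOm); auto. Qed.
End OneTerm.

Section ThreeTerms.
Variables (f1 f2 f3 : Fn) (O1 O2 O3 : Form2) (k1 k2 k3 : Form1) (p1 q1 r1 p2 q2 r2 p3 q3 r3 : C).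
Hypothesis HO1 : charged_form O1 k1 p1 q1 r1.
Hypothesis HO2 : charged_form O2 k2 p2 q2 r2.
Hypothesis HO3 : charged_form O3 k3 p3 q3 r3.
Hypothesis Hf1 : C2 U f1.
Hypothesis Hf2 : C2 U f2.
Hypothesis Hf3 : C2 U f3.
(** [F] has to agree with the sum on the domain only, which lets it be the self-dual part of another
    form. *)
Variable F : Form2.
Hypothesis HF : forall y m n, U y -> (m < 4)%nat -> (n < 4)%nat ->
  (F m n y = f1 y * O1 m n y + f2 y * O2 m n y + f3 y * O3 m n y)%C.

Lemma C1_terms m n : (m < 4)%nat -> (n < 4)%nat ->
  C1 U (fmul f1 O1 m n) /\ C1 U (fmul f2 O2 m n) /\ C1 U (fmul f3 O3 m n).
Proof.
  intros. split; [|split]; eauto using cf_C1_fmul.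
Qed.

Lemma delta2_three x n : U x -> (n < 4)%nat -> delta2 M a F n x =
  (theta f1 O1 k1 n x + theta f2 O2 k2 n x + theta f3 O3 k3 n x)%C.
Proof.
  intros H Hn.
  rewrite (delta2_sum3 F (fmul f1 O1) (fmul f2 O2) (fmul f3 O3)) by (auto using C1_terms).
  now rewrite (cf_delta2 _ _ _ _ _ _ HO1), (cf_delta2 _ _ _ _ _ _ HO2), (cf_delta2 _ _ _ _ _ _ HO3).
Qed.

Lemma frame_d1_delta2 x A B : U x -> (A < 4)%nat -> (B < 4)%nat ->
  frame2 M a (d1 (delta2 M a F)) A B x =
  (curlF (fun A B => frame2 M a (covH f1 k1) A B x) (Sf p1 q1 r1) A B
  + curlF (fun A B => frame2 M a (covH f2 k2) A B x) (Sf p2 q2 r2) A B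
  + curlF (fun A B => frame2 M a (covH f3 k3) A B x) (Sf p3 q3 r3) A B)%C.
Proof.
  intros H HA HB.
  rewrite <- (frame_d1_theta f1 O1 k1 p1 q1 r1), <- (frame_d1_theta f2 O2 k2 p2 q2 r2),
    <- (frame_d1_theta f3 O3 k3 p3 q3 r3) by auto.
  rewrite (frame2_ext (d1 (delta2 M a F)) (fun m n x => d1 (theta f1 O1 k1) m n x
    + d1 (theta f2 O2 k2) m n x + d1 (theta f3 O3 k3) m n x)%C).
  - rewrite !frame2_split. unfold sum4. ring.
  - intros m n Hm Hn. apply d1_sum3; auto.
    + intros. split; [|split]; eauto using cf_C1_theta.
    + intros; now apply delta2_three.
Qed.

Lemma frame_delta3_d2 x A B : U x -> (A < 4)%nat -> (B < 4)%nat ->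
  frame2 M a (delta3 M a (d2 F)) A B x =
  (divF (fun A B => frame2 M a (covH f1 k1) A B x) (Sf p1 q1 r1) A B
  + divF (fun A B => frame2 M a (covH f2 k2) A B x) (Sf p2 q2 r2) A B
  + divF (fun A B => frame2 M a (covH f3 k3) A B x) (Sf p3 q3 r3) A B)%C.
Proof.
  intros H HA HB.
  rewrite <- (frame_delta3_tau f1 O1 k1 p1 q1 r1), <- (frame_delta3_tau f2 O2 k2 p2 q2 r2),
    <- (frame_delta3_tau f3 O3 k3 p3 q3 r3) by auto.
  rewrite (frame2_ext (delta3 M a (d2 F)) (fun m n x => delta3 M a (tau f1 O1 k1) m n x
    + delta3 M a (tau f2 O2 k2) m n x + delta3 M a (tau f3 O3 k3) m n x)%C).
  - rewrite !frame2_split. unfold sum4. ring.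
  - intros m n Hm Hn. apply delta3_sum3; auto.
    + intros. split; [|split]; eauto using cf_C1_tau.
    + intros y m0 n0 p0 Hy Hm0 Hn0 Hp0.
      rewrite (d2_sum3 F (fmul f1 O1) (fmul f2 O2) (fmul f3 O3)) by (auto using C1_terms).
      now rewrite (cf_d2 _ _ _ _ _ _ HO1), (cf_d2 _ _ _ _ _ _ HO2), (cf_d2 _ _ _ _ _ _ HO3).
Qed.

Lemma Pselfdual_three x m n : U x -> (m < 4)%nat -> (n < 4)%nat -> Pselfdual M a F m n x = F m n x.
Proof.
  intros H Hm Hn. pose proof two_neq_0 as H2. rewrite Pselfdual_frame by auto.
  set (S := fun A B => (lamp a x ^ 2 * Sf (f1 x * p1 + f2 x * p2 + f3 x * p3)
    (f1 x * q1 + f2 x * q2 + f3 x * q3) (f1 x * r1 + f2 x * r2 + f3 x * r3) A B)%C).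
  assert (E : forall m n, (m < 4)%nat -> (n < 4)%nat -> F m n x = unframe S m n x).
  { intros. rewrite HF, (cf_unframe _ _ _ _ _ HO1), (cf_unframe _ _ _ _ _ HO2), (cf_unframe _ _ _ _ _ HO3) by auto.
    unfold S, unframe, sum4. cbn [Sf]. ring. }
  assert (E1 : forall A B, (A < 4)%nat -> (B < 4)%nat -> frame2 M a F A B x = S A B)
    by (intros; now apply frame2_unframe).
  rewrite E by auto. rewrite (unframe_ext _ (fun A B => 2 * S A B)%C).
  - unfold unframe, sum4. field. auto.
  - intros A B HA HB. rewrite E1 by auto.
    rewrite <- starF_starT by auto. rewrite (starF_ext _ S) by auto. rewrite starF_starT by auto.
    transitivity (S A B + lamp a x ^ 2 * (- Ci * starT (Sf (f1 x * p1 + f2 x * p2 + f3 x * p3)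
    (f1 x * q1 + f2 x * q2 + f3 x * q3) (f1 x * r1 + f2 x * r2 + f3 x * r3)) A B))%C.
    + unfold S. cases4 A; cases4 B; unfold starT; ring.
    + rewrite Sf_selfdual by auto. unfold S. ring.
Qed.

Lemma starT_plus3 y1 y2 y3 A B : starT (fun A B => y1 A B + y2 A B + y3 A B)%C A B =
  (starT y1 A B + starT y2 A B + starT y3 A B)%C.
Proof.
  unfold starT. do 4 (try destruct A as [|A]); do 4 (try destruct B as [|B]); ring.
Qed.

(** Here $2P_+=1-{\rm i}\star$ acts on $d\delta F$, and $-{\rm i}\star d\delta F=\delta dF$ holds
    for each of the three terms. *)
Lemma twice_dplus_delta2 x m n : U x -> (m < 4)%nat -> (n < 4)%nat ->
  (2 * dplus M a (delta2 M a F) m n x = d1 (delta2 M a F) m n x + delta3 M a (d2 F) m n x)%C.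
Proof.
  intros H Hm Hn. pose proof two_neq_0 as H2. unfold dplus. rewrite Pselfdual_frame by auto.
  rewrite <- (unframe_frame2 (d1 (delta2 M a F)) m n x),
    <- (unframe_frame2 (delta3 M a (d2 F)) m n x) by auto.
  rewrite (unframe_ext (fun A B => _ - _)%C (fun A B => frame2 M a (d1 (delta2 M a F)) A B x
     + frame2 M a (delta3 M a (d2 F)) A B x)%C).
  - unfold unframe, sum4. field. auto.
  - intros A B HA HB. rewrite frame_delta3_d2 by auto.
    (* Rewriting under the star goes through [starF], whose extensionality asks for equality at
       indices below 4 only. *)
    rewrite <- starF_starT by auto.
    rewrite (starF_ext _ _ A B (fun C0 D0 HC HD => frame_d1_delta2 x C0 D0 H HC HD)).
    rewrite starF_starT by auto. rewrite starT_plus3.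
    rewrite <- !divF_star_curlF by auto. ring.
Qed.

(** Diagonality follows once $2P_+$ returns each summand to its own line. The disjunction states
    this condition a single time for the three summands. *)
Lemma twice_dplus_delta2_diag x m n (w1 w2 w3 : C) : U x -> (m < 4)%nat -> (n < 4)%nat ->
  (forall f k p q r w, (f = f1 /\ k = k1 /\ p = p1 /\ q = q1 /\ r = r1 /\ w = w1) \/
     (f = f2 /\ k = k2 /\ p = p2 /\ q = q2 /\ r = r2 /\ w = w2) \/
     (f = f3 /\ k = k3 /\ p = p3 /\ q = q3 /\ r = r3 /\ w = w3) ->
    forall A B, (A < 4)%nat -> (B < 4)%nat ->
    let y := curlF (fun A B => frame2 M a (covH f k) A B x) (Sf p q r) in
    (y A B - Ci * starT y A B = w * (lamp a x ^ 2 * Sf p q r A B))%C) ->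
  (2 * dplus M a (delta2 M a F) m n x = w1 * O1 m n x + w2 * O2 m n x + w3 * O3 m n x)%C.
Proof.
  intros H Hm Hn Hw. pose proof two_neq_0 as H2. unfold dplus. rewrite Pselfdual_frame by auto.
  rewrite (cf_unframe _ _ _ _ _ HO1), (cf_unframe _ _ _ _ _ HO2), (cf_unframe _ _ _ _ _ HO3).
  rewrite (unframe_ext (fun A B => _ - _)%C (fun A B => w1 * (lamp a x ^ 2 * Sf p1 q1 r1 A B)
     + w2 * (lamp a x ^ 2 * Sf p2 q2 r2 A B) + w3 * (lamp a x ^ 2 * Sf p3 q3 r3 A B))%C).
  - unfold unframe, sum4. field. auto.
  - intros A B HA HB. rewrite frame_d1_delta2 by auto.
    rewrite <- starF_starT by auto.
    rewrite (starF_ext _ _ A B (fun C0 D0 HC HD => frame_d1_delta2 x C0 D0 H HC HD)).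
    rewrite starF_starT by auto. rewrite starT_plus3.
    rewrite <- (Hw f1 k1 p1 q1 r1 w1), <- (Hw f2 k2 p2 q2 r2 w2), <- (Hw f3 k3 p3 q3 r3 w3)
      by (auto; tauto). ring.
Qed.
End ThreeTerms.

(** * The three line subbundles and the two claims *)

Section Final.
Variable Acon : Form1.
Hypothesis HA : is_conn_form M a Acon.

Definition kapc (k : R) : Form1 := fun m x => (Ci * RtoC k * Acon m x)%C.

Lemma C1_kapc k m : (m < 4)%nat -> C1 U (kapc k m).
Proof.
  intros Hm. unfold kapc. apply C1_mult; [apply C1_const|].
  apply (C1_ext U (KerrDom_open4 M a) (Ac m)); [|now apply C1_Ac].
  intros; symmetry; now apply conn_form_closed.
Qed.

Lemma wedge_anti A B m n x : wedge M a A B m n x = (- wedge M a A B n m x)%C.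
Proof. unfold wedge. rewrite <- RtoC_opp. f_equal. ring. Qed.
Lemma Omega_anti i m n x : Omega M a i m n x = (- Omega M a i n m x)%C.
Proof.
  unfold Omega, Sigma. destruct i as [|[|[|i]]];
  rewrite (wedge_anti 0 _ m n), ?(wedge_anti 1 _ m n), ?(wedge_anti 2 _ m n), ?(wedge_anti 3 _ m n); ring.
Qed.

(** The normalisation of $\Omega^\pm$. The coefficients below keep the shape [e * Ci * c] with [e]
    equal to 1 or -1, to match [curlF_charged]. *)
Let c := (/ RtoC (sqrt 2))%C.

(** The parallel form is given charge 0 instead of a separate zero 1-form, so that the lemmas on
    [kapc] cover all three cases. *)
Lemma charged_omega : charged_form (omega M a) (kapc 0) 1 0 0.
Proof.
  split.
  - intros. apply C2_C1, C2_Omega.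
  - intros. now apply C1_kapc.
  - intros. apply Omega_anti.
  - intros. rewrite nabla_omega by auto. unfold kapc. ring.
  - intros. rewrite <- Omega_unframe. unfold omega, Omega. ring.
Qed.
Lemma charged_OmegaP : charged_form (OmegaP M a) (kapc (-1)) 0 c (1 * Ci * c).
Proof.
  split.
  - intros. apply C2_C1, C2_OmegaP.
  - intros. now apply C1_kapc.
  - intros. unfold OmegaP. rewrite (Omega_anti 2 m n), (Omega_anti 3 m n). field. apply sqrt2_neq_0.
  - intros x H k m n Hk Hm Hn. destruct (HA x H k m n Hk Hm Hn) as [E _]. unfold kapc.
    transitivity (nabla2 M a (OmegaP M a) k m n x + Ci * Acon k x * OmegaP M a m n x
      - Ci * Acon k x * OmegaP M a m n x)%C; [ring|rewrite E; ring].
  - intros. rewrite <- Omega_unframe. unfold OmegaP, Omega, c. field. apply sqrt2_neq_0.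
Qed.
Lemma charged_OmegaM : charged_form (OmegaM M a) (kapc 1) 0 c (RtoC (-1) * Ci * c).
Proof.
  split.
  - intros. apply C2_C1, C2_OmegaM.
  - intros. now apply C1_kapc.
  - intros. unfold OmegaM. rewrite (Omega_anti 2 m n), (Omega_anti 3 m n). field. apply sqrt2_neq_0.
  - intros x H k m n Hk Hm Hn. destruct (HA x H k m n Hk Hm Hn) as [_ E]. unfold kapc.
    transitivity (nabla2 M a (OmegaM M a) k m n x - Ci * Acon k x * OmegaM M a m n x
      + Ci * Acon k x * OmegaM M a m n x)%C; [ring|rewrite E; ring].
  - intros. rewrite <- Omega_unframe. unfold OmegaM, Omega, c. field. apply sqrt2_neq_0.
Qed.

Lemma frame_d1_kapc k x A B : U x ->
  frame2 M a (d1 (kapc k)) A B x = (Ci * RtoC k * frame2 M a (d1 Ac) A B x)%C.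
Proof.
  intros H.
  rewrite (frame2_ext _ (fun m n x => Ci * RtoC k * d1 Ac m n x)%C).
  - unfold frame2, sum4. ring.
  - intros m n Hm Hn. unfold d1.
    assert (E : forall i j, (i < 4)%nat -> (j < 4)%nat ->
       pd i (kapc k j) x = (Ci * RtoC k * pd i (Ac j) x)%C).
    { intros i j Hi Hj.
      rewrite (pd_ext U i _ (fun y => Ci * RtoC k * Ac j y)%C x (KerrDom_open4 M a) H).
      - rewrite (pd_mult U (fun _ => Ci * RtoC k)%C (Ac j) x i
          (C1_const U _) (C1_Ac j Hj) H Hi).
        rewrite (is_pd_unique _ _ _ _ (is_pd_const _ _ _)). ring.
      - intros y Hy. unfold kapc. now rewrite (conn_form_closed Acon HA). }
    rewrite !E by auto. ring.
Qed.

Lemma frame_covH_anti f k x A B : C2 U f -> U x ->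
  (frame2 M a (covH f (kapc k)) A B x - frame2 M a (covH f (kapc k)) B A x
   = Ci * RtoC k * frame2 M a (d1 Ac) A B x * f x)%C.
Proof.
  intros Hf H. rewrite <- frame_d1_kapc by auto.
  transitivity (frame2 M a (fun m n x => covH f (kapc k) m n x - covH f (kapc k) n m x)%C A B x).
  - rewrite !frame2_split. unfold sum4. ring.
  - rewrite (frame2_ext _ (fun m n x => d1 (kapc k) m n x * f x)%C).
    + rewrite !frame2_split. unfold sum4. ring.
    + intros. apply covH_anti; auto. apply C1_kapc.
Qed.

(** The term ${\rm i}k\,a^\alpha v_\alpha$ in the definition is the [kap] part of the charged
    Hessian, so the second-order part is minus a trace. *)
Lemma Ok_trace k f x : U x -> Ok M a k Acon f x =
  (- (/ lamp a x ^ 2 * sum4 (fun D => etaC D * frame2 M a (covH f (kapc k)) D D x))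
   + RtoC ((1 + 2 * k ^ 2) / 6) * scal M a x * f x)%C.
Proof.
  intros H. rewrite <- trace_frame. unfold Ok.
  change (fun al y => (pd al f y + Ci * RtoC k * Acon al y * f y)%C) with (covD f (kapc k)).
  f_equal. f_equal. unfold covH, sum4, kapc, covD. ring.
Qed.

Lemma boxg_trace f x : U x -> boxg M a f x =
  (/ lamp a x ^ 2 * sum4 (fun D => etaC D * frame2 M a (covH f (kapc 0)) D D x))%C.
Proof.
  intros H. rewrite <- trace_frame. unfold boxg.
  assert (E : covD f (kapc 0) = d0 f).
  { extensionality m. extensionality y. unfold covD, kapc, d0. ring. }
  apply sum4_ext; intros; apply sum4_ext; intros. f_equal. unfold covH. rewrite E. unfold kapc. ring.
Qed.

Lemma curl_omega f x : C2 U f -> U x -> forall A B, (A < 4)%nat -> (B < 4)%nat ->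
  let y := curlF (fun A B => frame2 M a (covH f (kapc 0)) A B x) (Sf 1 0 0) in
  (y A B - Ci * starT y A B = fneg (boxg M a f) x * (lamp a x ^ 2 * Sf 1 0 0 A B))%C.
Proof.
  intros Hf H A B HA' HB y. pose proof (lamp_neq_0 x H) as Hl. unfold fneg.
  unfold y. rewrite curlF_symmetric; auto.
  - rewrite boxg_trace by auto. field. auto.
  (* For charge 0 the commutator vanishes, so the Hessian is symmetric. *)
  - intros i j _ _. pose proof (frame_covH_anti f 0 x i j Hf H) as E.
    match goal with |- ?u = ?v => transitivity (v + (u - v))%C; [ring|] end. rewrite E. ring.
Qed.

(** The self-dual curvature gives ${\rm i}k\cdot 6{\rm i}M/$[zz ^ 3] $=e\cdot 6M/$[zz ^ 3], because
    $e=-k$. Divided by $\lambda_+^2$ this is $6M/$[zz] $=s/2$, in agreement with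
    $(1+2k^2)/6=1/2$. *)
Lemma curl_charged e k f x : (e = RtoC 1 /\ k = -1) \/ (e = RtoC (-1) /\ k = 1) ->
  C2 U f -> U x -> forall A B, (A < 4)%nat -> (B < 4)%nat ->
  let y := curlF (fun A B => frame2 M a (covH f (kapc k)) A B x) (Sf 0 c (e * Ci * c)) in
  (y A B - Ci * starT y A B = Ok M a k Acon f x * (lamp a x ^ 2 * Sf 0 c (e * Ci * c) A B))%C.
Proof.
  intros He Hf H A B HA' HB y. pose proof (lamp_neq_0 x H) as Hl.
  pose proof (zz_neq_0 x H) as Hz.
  destruct (frame_dAc x H) as [P1 [P2 P3]].
  assert (Hs : RtoC ((1 + 2 * k ^ 2) / 6) = (RtoC 1 / RtoC 2)%C).
  { rewrite <- RtoC_div by lra. f_equal. destruct He as [[_ ->]|[_ ->]]; simpl; field. }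
  unfold y. rewrite (curlF_charged e _ (fun i j => Ci * RtoC k * frame2 M a (d1 Ac) i j x * f x)%C c
     (RtoC 6 * RtoC M / zz x ^ 3 * f x)%C); auto.
  - rewrite Ok_trace, scal_closed, Hs by auto. rewrite lamp_zz in *. fieldC.
  - destruct He as [[-> _]|[-> _]]; auto.
  - intros. now apply frame_covH_anti.
  - transitivity (Ci * RtoC k * f x * (frame2 M a (d1 Ac) 0 1 x - Ci * frame2 M a (d1 Ac) 2 3 x))%C;
      [ring|rewrite P1]. destruct He as [[-> ->]|[-> ->]]; field; auto.
  - transitivity (Ci * RtoC k * f x * (frame2 M a (d1 Ac) 0 2 x - Ci * frame2 M a (d1 Ac) 3 1 x))%C;
      [ring|rewrite P2; ring].
  - transitivity (Ci * RtoC k * f x * (frame2 M a (d1 Ac) 0 3 x - Ci * frame2 M a (d1 Ac) 1 2 x))%C;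
      [ring|rewrite P3; ring].
Qed.

Lemma Oop_decomposed (Phi PhiP PhiM : Fn) :
  C2 U Phi -> C2 U PhiP -> C2 U PhiM ->
  forall x, U x -> forall m n, (m < 4)%nat -> (n < 4)%nat ->
  Oop M a (fadd (fadd (fmul Phi (omega M a)) (fmul PhiM (OmegaP M a)))
                (fmul PhiP (OmegaM M a))) m n x =
  (fneg (boxg M a Phi) x * omega M a m n x + Ok M a (-1) Acon PhiM x * OmegaP M a m n x
   + Ok M a 1 Acon PhiP x * OmegaM M a m n x)%C.
Proof.
  intros H0 HP HM x H m n Hm Hn. unfold Oop, dplus_star.
  set (F := fadd (fadd (fmul Phi (omega M a)) (fmul PhiM (OmegaP M a))) (fmul PhiP (OmegaM M a))).
  assert (HF : forall y m n, U y -> (m < 4)%nat -> (n < 4)%nat ->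
     Pselfdual M a F m n y = (Phi y * omega M a m n y + PhiM y * OmegaP M a m n y + PhiP y * OmegaM M a m n y)%C).
  { intros. rewrite (Pselfdual_three Phi PhiM PhiP _ _ _ _ _ _ _ _ _ _ _ _ _ _ _
      charged_omega charged_OmegaP charged_OmegaM); auto. }
  apply (twice_dplus_delta2_diag Phi PhiM PhiP _ _ _ _ _ _ _ _ _ _ _ _ _ _ _
      charged_omega charged_OmegaP charged_OmegaM H0 HM HP (Pselfdual M a F) HF x m n); auto.
  intros f k p q r w Hc A B HA' HB.
  destruct Hc as [[-> [-> [-> [-> [-> ->]]]]] | [[-> [-> [-> [-> [-> ->]]]]] | [-> [-> [-> [-> [-> ->]]]]]]].
  - apply curl_omega; auto.
  - apply (curl_charged (RtoC 1)); auto.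
  - apply (curl_charged (RtoC (-1))); auto.
Qed.

(** The self-dual part of [B] is expanded in $\omega,\Omega^+,\Omega^-$ with coefficients of class
    [C2], which reduces the claim to sums of three recurrent terms. *)
Lemma Oop_HodgeLap (B : Form2) : (forall m n x, B m n x = fneg (B n m) x) ->
  (forall m n, (m < 4)%nat -> (n < 4)%nat -> C2 U (B m n)) ->
  forall x, U x -> forall m n, (m < 4)%nat -> (n < 4)%nat ->
  Oop M a B m n x = HodgeLap M a (Pselfdual M a B) m n x.
Proof.
  intros HB HC x H m n Hm Hn. pose proof (KerrDom_open4 M a) as HU.
  pose proof two_neq_0 as H2. pose proof sqrt2_neq_0 as Hs2.
  set (p := fun i j y => (/ 2 * (frame2 M a B i j y - Ci * starT (fun i j => frame2 M a B i j y) i j))%C).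
  (* The coefficient of $\Omega^j$ is read off from the frame entry [0 j], which is ${\rm
     i}\lambda_+^2$ times it. *)
  set (b1 := fun y => (- Ci * p 0%nat 1%nat y / lamp a y ^ 2)%C).
  set (b2 := fun y => (- Ci * p 0%nat 2%nat y / lamp a y ^ 2)%C).
  set (b3 := fun y => (- Ci * p 0%nat 3%nat y / lamp a y ^ 2)%C).
  assert (Cf : forall i j, C2 U (fun y => frame2 M a B i j y)).
  { intros. unfold frame2.
    apply (C2_sum4 U HU (fun m0 y => sum4 (fun n0 => RtoC (fr M a i m0 y * fr M a j n0 y) * B m0 n0 y))%C).
    intros m0 Hm0.
    apply (C2_sum4 U HU (fun n0 y => RtoC (fr M a i m0 y * fr M a j n0 y) * B m0 n0 y)%C).
    intros n0 Hn0. apply C2_mult; auto.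
    apply (C2_ext U HU (fun y => RtoC (fr M a i m0 y) * RtoC (fr M a j n0 y))%C).
    - intros; now rewrite RtoC_mult.
    - apply C2_mult; auto using C2_fr. }
  pose proof (C2_lamp) as Cl.
  assert (Cb : C2 U b1 /\ C2 U b2 /\ C2 U b3).
  { unfold b1, b2, b3, p, starT.
    split; [|split]; (apply C2_div; [exact HU| |apply (C2_pow U HU (lamp a)); exact Cl
      |intros; apply Cpow_neq_0; now apply (lamp_neq_0)]);
    pose proof (Cf 0%nat 1%nat); pose proof (Cf 0%nat 2%nat); pose proof (Cf 0%nat 3%nat);
    pose proof (Cf 1%nat 2%nat); pose proof (Cf 2%nat 1%nat); pose proof (Cf 1%nat 3%nat);
    pose proof (Cf 3%nat 1%nat); pose proof (Cf 2%nat 3%nat); pose proof (Cf 3%nat 2%nat);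
    C2_tac. }
  destruct Cb as [C1b [C2b C3b]].
  (* The inverse of the change of basis: $b_2\Omega^2+b_3\Omega^3=\frac{b_2-{\rm
     i}b_3}{\sqrt2}\Omega^++\frac{b_2+{\rm i}b_3}{\sqrt2}\Omega^-$. *)
  set (fP := fun y => (c * (b2 y - Ci * b3 y))%C).
  set (fM := fun y => (c * (b2 y + Ci * b3 y))%C).
  assert (CP : C2 U fP) by (unfold fP; C2_tac).
  assert (CM : C2 U fM) by (unfold fM; C2_tac).
  assert (HF : forall y i j, U y -> (i < 4)%nat -> (j < 4)%nat ->
     Pselfdual M a B i j y = (b1 y * omega M a i j y + fP y * OmegaP M a i j y + fM y * OmegaM M a i j y)%C).
  { intros y i j Hy Hi Hj. rewrite Pselfdual_frame by auto.
    pose proof (lamp_neq_0 y Hy) as Hl.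
    transitivity (unframe (fun A B => lamp a y ^ 2 * Sf (b1 y) (b2 y) (b3 y) A B)%C i j y).
    - transitivity (unframe (fun A B => p A B y) i j y).
      + unfold unframe, p, sum4. ring.
      + apply unframe_ext. intros A B0 HA' HB'.
        unfold p. rewrite (selfdual_Sf (fun i j => frame2 M a B i j y) A B0 HA' HB').
        * unfold b1, b2, b3, p. cases4 A; cases4 B0; cbn [Sf]; field; auto.
        * intros i0 j0 _ _. rewrite !frame2_split.
          unfold sum4. rewrite (HB 0%nat 0%nat), (HB 1%nat 1%nat), (HB 2%nat 2%nat), (HB 3%nat 3%nat).
          rewrite (HB 1%nat 0%nat), (HB 2%nat 0%nat), (HB 3%nat 0%nat), (HB 2%nat 1%nat), (HB 3%nat 1%nat), (HB 3%nat 2%nat).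
          unfold fneg.
          assert (Z : forall k, B k k y = RtoC 0).
          { intros k. transitivity (/ 2 * (B k k y + B k k y))%C; [field; auto|].
            rewrite (HB k k) at 1. unfold fneg. ring. }
          rewrite !Z. ring.
    - rewrite <- Omega_unframe. unfold omega, OmegaP, OmegaM, Omega, fP, fM, c.
      assert (E2 : (RtoC (sqrt 2) * RtoC (sqrt 2) = 2)%C).
      { rewrite <- RtoC_mult. f_equal. apply sqrt_sqrt. lra. }
      transitivity (lamp a y ^ 2 * (b1 y * Sigma M a 1 i j y
         + 2 * / (RtoC (sqrt 2) * RtoC (sqrt 2)) * (b2 y * Sigma M a 2 i j y + b3 y * Sigma M a 3 i j y)))%C.
      + rewrite E2. field. auto.
      + field. auto. }
  unfold Oop, dplus_star, HodgeLap.
  apply (twice_dplus_delta2 b1 fP fM _ _ _ _ _ _ _ _ _ _ _ _ _ _ _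
      charged_omega charged_OmegaP charged_OmegaM C1b CP CM (Pselfdual M a B) HF x m n); auto.
Qed.
End Final.
End KerrMetric.

Theorem theoremB (M a : R) (Acon : Form1) :
  is_conn_form M a Acon ->
  (* O := 2 d_+ d_+^* = Delta_H P_+ *)
  (forall B : Form2, (forall m n x, B m n x = fneg (B n m) x) ->
     (forall m n, smooth_on (KerrDom M a) (B m n)) ->
     forall x, KerrDom M a x -> forall m n, (m < 4)%nat -> (n < 4)%nat ->
       Oop M a B m n x = HodgeLap M a (Pselfdual M a B) m n x) /\
  (* action of O on Phi omega + Phi^- Omega^+ + Phi^+ Omega^- *)
  (forall Phi PhiP PhiM : Fn,
     smooth_on (KerrDom M a) Phi -> smooth_on (KerrDom M a) PhiP -> smooth_on (KerrDom M a) PhiM ->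
     forall x, KerrDom M a x -> forall m n, (m < 4)%nat -> (n < 4)%nat ->
       Oop M a (fadd (fadd (fmul Phi (omega M a)) (fmul PhiM (OmegaP M a)))
                     (fmul PhiP (OmegaM M a))) m n x =
       fadd (fadd (fmul (fneg (boxg M a Phi)) (omega M a))
                  (fmul (Ok M a (-1) Acon PhiM) (OmegaP M a)))
            (fmul (Ok M a 1 Acon PhiP) (OmegaM M a)) m n x).
Proof.
  intros HA. pose proof (fun F => smooth_on_C2 _ F (KerrDom_box_open M a)) as HS. split.
  - intros B HB HC x H m n Hm Hn. apply (Oop_HodgeLap M a Acon HA B); auto.
  - intros Phi PhiP PhiM H1 H2 H3 x H m n Hm Hn.
    rewrite (Oop_decomposed M a Acon HA) by auto. reflexivity.
Qed.
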